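(* Let $L$ be an oriented link with $n$ components. Then \[ \theta(q,E)(L) = \sum_{k=1}^n (-1)^{k-1} (q+q^{-1})^{k-1} E_k \sum_{\pi} q^{4\nu(\pi)}\, V(\pi L), \] where the second summation is over all partitions $\pi$ of the set of components of $L$ into $k$ (unordered, nonempty) subsets; $V(\pi L)$ denotes the product of the Jones polynomials of the $k$ sublinks of $L$ defined by $\pi$; $\nu(\pi)$ is the sum of the linking numbers of all pairs of components of $L$ that lie in distinct sets of $\pi$; and $E_k = (E^{-1}-1)(E^{-1}-2)\cdots(E^{-1}-k+1)$, with $E_1=1$.
   Context: The Jones polynomial $V$ is normalized as the ambient isotopy invariant of oriented links with values in $\mathbb{C}[q^{\pm1}]$ with $V(\text{unknot})=1$ and $q^{-2}V(L_+)-q^2V(L_-)=(q-q^{-1})V(L_0)$ for all oriented Conway triples (diagrams identical except near one point, where they have respectively a positive crossing, a negative crossing, and the orientation-respecting smoothing). $\theta=\theta(q,E)$ is the unique ambient isotopy invariant of oriented links with values in $\mathbb{C}[q^{\pm1},E^{\pm1}]$ ($q,E$ indeterminates) such that: (1) $q^{-2}\theta(L_+)-q^2\theta(L_-)=(q-q^{-1})\theta(L_0)$ for every oriented Conway triple whose distinguished crossing is between two different components; (2) $\theta(\mathcal{K})=E^{1-r}V(\mathcal{K})$ for every split union $\mathcal{K}$ of $r\ge1$ knots. The existence and uniqueness of $\theta$ may be assumed. The linking number of two components is half the sum of the signs of the crossings between them. *)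

(* Defs.v *)
From HB Require Import structures.
From Stdlib Require Import Relation_Operators.
From mathcomp Require Import all_boot all_order all_algebra.
From mathcomp Require Import reals.
From mathcomp Require Import complex.

Set Implicit Arguments.
Unset Strict Implicit.
Unset Printing Implicit Defensive.

Import Order.TTheory GRing.Theory Num.Theory.

Local Open Scope ring_scope.

(* Oriented link diagrams.

   A planar diagram in general position for the height function is cut into
   horizontal slices, each containing exactly one minimum, maximum or crossing;
   the diagram is the list of its slices, read from bottom to top.  The slice
   (i, g) has i strands to the left of its event g.
   - Cup o is a minimum.  It is a local minimum of an oriented curve; o tells
     whether the left branch goes up (then the right one goes down).
   - Cap is a maximum.
   - Cross b is a crossing; b tells whether the strand that joins the bottom
     left corner to the top right corner is the over-strand.
   Planarity is built in, and every link diagram in the plane is isotopic to a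
   diagram of this kind. *)
Inductive event := Cup of bool | Cap | Cross of bool.

Definition slice : Type := (nat * event)%type.
Definition word : Type := seq slice.

Definition slice_at (w : word) (t : nat) : slice := nth (0, Cap)%N w t.

(* A strand cut by a horizontal line: its direction (true = upwards), and the
   index of the slice containing the minimum that it comes from when it is
   followed downwards. *)
Definition strand : Type := (bool * nat)%type.

Definition step (t : nat) (x : slice) (st : seq strand) : seq strand :=
  let i := x.1 in
  match x.2 with
  | Cup o => take i st ++ (o, t) :: (~~ o, t) :: drop i st
  | Cap => take i st ++ drop i.+2 st
  | Cross _ => take i st ++ nth (true, 0%N) st i.+1 :: nth (true, 0%N) st i
                 :: drop i.+2 st
  end.

(* The strands met, from left to right, just below the slice number t. *)
Fixpoint level (w : word) (t : nat) : seq strand :=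
  if t is t'.+1 then step t' (slice_at w t') (level w t') else [::].

Definition strand_at (w : word) (t p : nat) : strand :=
  nth (true, 0%N) (level w t) p.

Definition fits (x : slice) (st : seq strand) : bool :=
  let i := x.1 in
  match x.2 with
  | Cup _ => (i <= size st)%N
  | Cap => (i.+1 < size st)%N
           && ((nth (true, 0%N) st i).1 != (nth (true, 0%N) st i.+1).1)
  | Cross _ => (i.+1 < size st)%N
  end.

(* Links are nonempty. *)
Definition diagram (w : word) : bool :=
  [&& (0 < size w)%N,
      all (fun t => fits (slice_at w t) (level w t)) (iota 0 (size w))
    & nilp (level w (size w))].

(* Components.  Every component contains a minimum, and two minima lie on the
   same component exactly when they can be joined by successive maxima; a
   component is represented by the set of (the slices of) its minima. *)
Definition minima (w : word) : {set 'I_(size w)} :=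
  [set t : 'I_(size w) | if (slice_at w t).2 is Cup _ then true else false].

Definition joined (w : word) (s t : 'I_(size w)) : bool :=
  [exists u : 'I_(size w),
     let i := (slice_at w u).1 in
     let x := (strand_at w u i).2 in
     let y := (strand_at w u i.+1).2 in
     if (slice_at w u).2 is Cap
     then (x == s) && (y == t) || (x == t) && (y == s) else false].

Definition components (w : word) : {set {set 'I_(size w)}} :=
  equivalence_partition (connect (@joined w)) (minima w).

(* The strand x lies on one of the components whose union is A. *)
Definition on (w : word) (A : {set 'I_(size w)}) (x : strand) : bool :=
  [exists s in A, val s == x.2].

Definition knot (w : word) : bool := diagram w && (#|components w| == 1)%N.

Definition unknot : word := [:: (0, Cup true); (0, Cap)]%N.

(* The split union of link diagrams: they are stacked, each above the previous
   one and disjoint from it. *)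
Definition split_union (ks : seq word) : word := flatten ks.

(* The sublink with union of components A: all other strands are erased. *)
Definition sublink_slice (w : word) (A : {set 'I_(size w)}) (t : 'I_(size w)) :
    option slice :=
  let i := (slice_at w t).1 in
  let e := (slice_at w t).2 in
  let i' := count (on A) (take i (level w t)) in
  let keep := match e with
    | Cup _ => t \in A
    | Cap | Cross _ => on A (strand_at w t i) && on A (strand_at w t i.+1)
    end in
  if keep then Some (i', e) else None.

Definition sublink (w : word) (A : {set 'I_(size w)}) : word :=
  pmap (sublink_slice A) (enum 'I_(size w)).

(* With b = true and both strands directed upwards, the over-strand goes to the
   top right and the under-strand to the top left: this is a positive crossing.
   Reversing one strand or exchanging over and under changes the sign. *)
Definition positive (b : bool) (x y : strand) : bool := b == (x.1 == y.1).

Definition crossing_sign (w : word) (t : nat) : int :=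
  let i := (slice_at w t).1 in
  if (slice_at w t).2 is Cross b then
    if positive b (strand_at w t i) (strand_at w t i.+1) then 1 else -1
  else 0.

Definition crossing_between (w : word) (A B : {set 'I_(size w)}) (t : nat) :
    bool :=
  let i := (slice_at w t).1 in
  let x := strand_at w t i in
  let y := strand_at w t i.+1 in
  if (slice_at w t).2 is Cross _
  then on A x && on B y || on B x && on A y else false.

(* Two distinct components cross each other an even number of times, so that
   the division is exact. *)
Definition linking_number (w : word) (A B : {set 'I_(size w)}) : int :=
  ((\sum_(t < size w | crossing_between A B t) crossing_sign w t) %/ 2)%Z.

(* The sum of the linking numbers over the unordered pairs of components that
   lie in distinct blocks of P; enum_rank only serves to take each unordered
   pair once. *)
Definition nu (w : word) (P : {set {set {set 'I_(size w)}}}) : int :=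
  \sum_(A in components w)
    \sum_(B in components w |
          (enum_rank A < enum_rank B)%N && (pblock P A != pblock P B))
      linking_number A B.

(* Ambient isotopy: the equivalence relation on diagrams generated by isotopies
   of the plane (the first five constructors) and by the three Reidemeister
   moves.  The orientations of the strands entering from below are arbitrary,
   and those of the cups are then forced since both sides have to occur in
   oriented diagrams. *)
Definition inputs (e : event) : nat := if e is Cup _ then 0%N else 2.
Definition outputs (e : event) : nat := if e is Cap then 0%N else 2.

Inductive local_move : word -> word -> Prop :=
| move_commute (i d : nat) (e f : event) :
    local_move [:: (i, e); (i + outputs e + d, f)]%N
               [:: (i + inputs e + d, f); (i, e)]%N
| move_zigzag_right (i : nat) (o : bool) :
    local_move [:: (i.+1, Cup o); (i, Cap)] [::]
| move_zigzag_left (i : nat) (o : bool) :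
    local_move [:: (i, Cup o); (i.+1, Cap)] [::]
| move_slide_cup (i : nat) (o b : bool) :
    local_move [:: (i.+1, Cup o); (i, Cross b)]
               [:: (i, Cup o); (i.+1, Cross (~~ b))]
| move_slide_cap (i : nat) (b : bool) :
    local_move [:: (i, Cross b); (i.+1, Cap)]
               [:: (i.+1, Cross (~~ b)); (i, Cap)]
| move_R1_right (i : nat) (o b : bool) :
    local_move [:: (i.+1, Cup o); (i, Cross b); (i.+1, Cap)] [::]
| move_R1_left (i : nat) (o b : bool) :
    local_move [:: (i, Cup o); (i.+1, Cross b); (i, Cap)] [::]
| move_R2 (i : nat) (b : bool) :
    local_move [:: (i, Cross b); (i, Cross (~~ b))] [::]
(* The hypothesis of the third move excludes the two cases in which the
   relation "passes over" is cyclic on the three strands. *)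
| move_R3 (i : nat) (b c d : bool) :
    ~~ ((b == d) && (c != b)) ->
    local_move [:: (i, Cross b); (i.+1, Cross c); (i, Cross d)]
               [:: (i.+1, Cross d); (i, Cross c); (i.+1, Cross b)].

Definition diagram_move (w w' : word) : Prop :=
  [/\ diagram w, diagram w'
    & exists u a b v,
        [/\ w = u ++ a ++ v, w' = u ++ b ++ v & local_move a b]].

Definition isotopic : word -> word -> Prop :=
  clos_refl_sym_trans word diagram_move.

Definition isotopy_invariant (T : Type) (f : word -> T) : Prop :=
  forall w w', isotopic w w' -> f w = f w'.

(* Conway triples.  The smoothing of a crossing whose strands point in the same
   vertical direction is vertical; otherwise it consists of a maximum below a
   minimum, and the left branch of this minimum has the direction of the strand
   leaving the crossing by its top left corner. *)
Definition smoothing (i : nat) (x y : strand) : word :=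
  if x.1 == y.1 then [::] else [:: (i, Cap); (i, Cup y.1)].

(* The distinguished crossing is the slice number t, at position i. *)
Definition conway_triple (t i : nat) (Lp Lm L0 : word) : Prop :=
  exists u v b,
    [/\ size u = t,
        Lp = u ++ (i, Cross b) :: v,
        Lm = u ++ (i, Cross (~~ b)) :: v
      & L0 = u ++ smoothing i (strand_at Lp t i) (strand_at Lp t i.+1) ++ v]
    /\ diagram Lp
    /\ positive b (strand_at Lp t i) (strand_at Lp t i.+1).

Definition between_distinct_components (w : word) (t : nat) : bool :=
  [exists A in components w, exists B in components w,
    (A != B) && crossing_between A B t].

(* Laurent polynomials, as elements of the field of fractions C(q, E) of
   C[q][E]. *)
Section Invariants.
Variable R : realType.

Definition ratfun := {fraction {poly {poly R[i]}}}.

Definition q : ratfun := @tofrac {poly {poly R[i]}} ('X%:P).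
Definition E : ratfun := @tofrac {poly {poly R[i]}} 'X.

Definition laurent_q (f : ratfun) : Prop :=
  exists (p : {poly R[i]}) (m : nat),
    f = @tofrac {poly {poly R[i]}} (p%:P) / q ^+ m.

Definition laurent_qE (f : ratfun) : Prop :=
  exists (p : {poly {poly R[i]}}) (m n : nat),
    f = @tofrac {poly {poly R[i]}} p / (q ^+ m * E ^+ n).

Definition skein (f : word -> ratfun) (Lp Lm L0 : word) : Prop :=
  q ^ (-2) * f Lp - q ^ 2 * f Lm = (q - q^-1) * f L0.

Definition jones_rules (V : word -> ratfun) : Prop :=
  [/\ forall w, diagram w -> laurent_q (V w),
      isotopy_invariant V,
      V unknot = 1
    & forall t i Lp Lm L0, conway_triple t i Lp Lm L0 -> skein V Lp Lm L0].

(* The invariants are functions of words; only their values on diagrams are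
   meaningful, and uniqueness is uniqueness on diagrams. *)
Definition is_jones (V : word -> ratfun) : Prop :=
  jones_rules V
  /\ forall V', jones_rules V' -> forall w, diagram w -> V' w = V w.

Definition theta_rules (V theta : word -> ratfun) : Prop :=
  [/\ forall w, diagram w -> laurent_qE (theta w),
      isotopy_invariant theta,
      forall t i Lp Lm L0, conway_triple t i Lp Lm L0 ->
        between_distinct_components Lp t -> skein theta Lp Lm L0
    & forall ks : seq word, (0 < size ks)%N -> all knot ks ->
        theta (split_union ks) = E ^ (1 - (size ks)%:Z) * V (split_union ks)].

Definition is_theta (V theta : word -> ratfun) : Prop :=
  theta_rules V theta
  /\ forall theta', theta_rules V theta' ->
     forall w, diagram w -> theta' w = theta w.

Definition Ek (k : nat) : ratfun := \prod_(1 <= j < k) (E^-1 - j%:R).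

(* The product of the values of V on the sublinks defined by the blocks of P;
   cover B is the union of the components belonging to the block B. *)
Definition V_partition (V : word -> ratfun) (w : word)
    (P : {set {set {set 'I_(size w)}}}) : ratfun :=
  \prod_(B in P) V (sublink (cover B)).

End Invariants.

Arguments q {R}.
Arguments E {R}.
Arguments Ek {R} k.

(* Main.v *)
(* A colouring of the strands of a diagram that is constant along components is
   encoded by a list of coloured slices that runs from the empty level to the
   empty level.  The right-hand side of the formula only depends on such a
   colouring, provided that it has as many colours as there are components.  It
   satisfies the rules that characterize theta:
   - isotopy: each local move carries colourings along, and erasing colours
     turns it into a local move or an equality;
   - skein relation at a crossing of colours a and b: partitions separating a
     from b cancel since the linking numbers differ by 1; the other ones
     correspond to the partitions for the smoothing, in which a and b are
     merged, and the skein relation of V applies to the block containing them;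
   - split unions of r knots: by uniqueness of V, it is multiplicative up to
     delta = - (q + q^-1), and the sum of x (x - 1) ... (x - #|P| + 1) over the
     partitions P of r elements is x ^ r. *)
Require Import Defs.
From Stdlib Require Import Relation_Operators.
From mathcomp Require Import all_boot all_order all_algebra.
From mathcomp Require Import reals complex.
From mathcomp Require Import zify ring.
Import GRing.Theory.
Local Open Scope ring_scope.

Set Implicit Arguments.
Unset Strict Implicit.
Unset Printing Implicit Defensive.

(** * Coloured words *)

(** The components of a diagram are sets over an ordinal type that depends on the length of the
    word, so every move, crossing change or smoothing would change the type of all partitions.
    Colours live in a type that stays fixed while the word changes. The price is the proviso on the
    number of colours, to be checked again after each change of diagram. It is handled by a
    universal property: every colouring is a renaming of the colouring by components, so the number
    of components is the largest possible number of colours, and a colouring that attains it is an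
    injective renaming. The constants fit as follows. Twice [nu] is the signed number of crossings
    between different blocks. A crossing change alters it by 2, hence multiplies [q ^ (4 * nu)] by
    [q ^ 4] or its inverse, which is the ratio of the two coefficients on the left of the skein
    relation. For r split knots, a partition with k blocks contributes the power k - 1 of delta
    through its coefficient and r - k through its blocks, in total r - 1 whatever the partition.
    What remains is a sum of falling factorials of [E^-1], each lacking its first factor. *)

Inductive cevent (T : Type) := CCup of bool & T | CCap | CCross of bool.
Arguments CCap {T}.
Arguments CCross {T} b.
Definition cslice (T : Type) : Type := (nat * cevent T)%type.
Definition cword (T : Type) : Type := seq (cslice T).
(** Directions and colours of the strands cut by a horizontal line. A word stores colours only at
    its minima; all other strands inherit theirs from below. *)
Definition cstate (T : Type) : Type := seq (bool * T).

Definition plain (T : Type) (x : cslice T) : slice :=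
  (x.1, match x.2 with
        | CCup o _ => Cup o | CCap => Cap | CCross b => Cross b end).

Definition plainw (T : Type) : cword T -> word := map (@plain T).

Definition recolor_event (T U : Type) (g : T -> U) (e : cevent T) : cevent U :=
  match e with
  | CCup o c => CCup o (g c) | CCap => CCap | CCross b => CCross b
  end.

Definition recolor (T U : Type) (g : T -> U) : cword T -> cword U :=
  map (fun x => (x.1, recolor_event g x.2)).

Definition recolor_st (T U : Type) (g : T -> U) : cstate T -> cstate U :=
  map (fun x => (x.1, g x.2)).

Lemma plainw_recolor (T U : Type) (g : T -> U) (w : cword T) :
  plainw (recolor g w) = plainw w.
Proof. by elim: w => //= -[i [o c||b]] w ->. Qed.

Lemma recolor_cat (T U : Type) (g : T -> U) (u v : cword T) :
  recolor g (u ++ v) = recolor g u ++ recolor g v.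
Proof. exact: map_cat. Qed.

Lemma plainw_cat (T : Type) (u v : cword T) :
  plainw (u ++ v) = plainw u ++ plainw v.
Proof. exact: map_cat. Qed.

Lemma plainw_eq_cat (T : Type) (w : cword T) (u v : word) :
  plainw w = u ++ v ->
  exists cu cv, [/\ w = cu ++ cv, plainw cu = u & plainw cv = v].
Proof.
move=> h; exists (take (size u) w), (drop (size u) w).
by rewrite cat_take_drop /plainw map_take map_drop -/(plainw w) h
  take_size_cat ?drop_size_cat.
Qed.

Section Colored.
Variable T : eqType.
Implicit Types (e : cevent T) (s st p : cstate T) (w : cword T).
Implicit Types (P : pred T) (r : rel T).

(** Failing at a maximum that would join two colours is what makes a run from the empty state to
    itself a colouring constant along components. *)
Definition act e s : option (cstate T) :=
  match e, s with
  | CCup o c, _ => Some ((o, c) :: (~~ o, c) :: s)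
  | CCap, x :: y :: s' =>
      if (x.1 != y.1) && (x.2 == y.2) then Some s' else None
  | CCross _, x :: y :: s' => Some (y :: x :: s')
  | _, _ => None
  end.

Definition cstep (x : cslice T) st : option (cstate T) :=
  if (x.1 <= size st)%N then omap (cat (take x.1 st)) (act x.2 (drop x.1 st))
  else None.

Fixpoint crun w st : option (cstate T) :=
  if w is x :: w' then obind (crun w') (cstep x st) else Some st.

(* [csub P w st] erases the strands whose colour is not in P; its positions
   count the remaining strands on the left. *)
Definition kept P e s : bool :=
  match e, s with
  | CCup _ c, _ => P c
  | _, x :: y :: _ => P x.2 && P y.2
  | _, _ => false
  end.

Definition csub1 P (x : cslice T) st : cword T :=
  if kept P x.2 (drop x.1 st)
  then [:: (count (fun y => P y.2) (take x.1 st), x.2)] else [::].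

Fixpoint csub P w st : cword T :=
  if w is x :: w' then csub1 P x st ++ csub P w' (odflt [::] (cstep x st))
  else [::].

(** The relation [r] selects the crossings that count: on the colouring by components, [between A B]
    yields twice a linking number, and separation by a partition yields twice [nu]. *)
Definition act_sign r e s : int :=
  match e, s with
  | CCross b, x :: y :: _ =>
      if r x.2 y.2 then (if b == (x.1 == y.1) then 1 else -1) else 0
  | _, _ => 0
  end.

Definition csign r (x : cslice T) st : int := act_sign r x.2 (drop x.1 st).

Fixpoint csum r w st : int :=
  if w is x :: w' then csign r x st + csum r w' (odflt [::] (cstep x st))
  else 0.

Definition used w : seq T :=
  pmap (fun x : cslice T => if x.2 is CCup _ c then Some c else None) w.

Definition colors st : seq T := [seq x.2 | x <- st].

Lemma cstep_cat p s i e :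
  cstep ((size p + i)%N, e) (p ++ s) = omap (cat p) (cstep (i, e) s).
Proof.
rewrite /cstep /= size_cat leq_add2l; case: ifP => // _.
by rewrite drop_cat ltnNge leq_addr addKn take_cat ltnNge leq_addr addKn /=;
   case: act => //= a; rewrite catA.
Qed.

Lemma cstepE p s e : cstep (size p, e) (p ++ s) = omap (cat p) (act e s).
Proof. by rewrite -[size p]addn0 cstep_cat /cstep /= take0 drop0; case: act. Qed.

Lemma csub1E P p s e :
  csub1 P (size p, e) (p ++ s) =
  if kept P e s then [:: (count (fun y => P y.2) p, e)] else [::].
Proof. by rewrite /csub1 /= drop_size_cat // take_size_cat. Qed.

Lemma csignE r p s e : csign r (size p, e) (p ++ s) = act_sign r e s.
Proof. by rewrite /csign /= drop_size_cat. Qed.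

Lemma cstepP x st st' : cstep x st = Some st' ->
  exists p s s', [/\ st = p ++ s, x.1 = size p, act x.2 s = Some s'
                   & st' = p ++ s'].
Proof.
rewrite /cstep; case: ifP => // le_x; case E: act => [s'|] //= [<-].
exists (take x.1 st), (drop x.1 st), s'; split=> //.
  by rewrite cat_take_drop.
by rewrite size_takel.
Qed.

Lemma crun_cat u v st : crun (u ++ v) st = obind (crun v) (crun u st).
Proof. by elim: u st => //= x u IH st; case: cstep => //= st'; rewrite IH. Qed.

Lemma crun_cat_some u v st st' : crun (u ++ v) st = Some st' ->
  exists2 st1, crun u st = Some st1 & crun v st1 = Some st'.
Proof. by rewrite crun_cat; case: crun => //= st1; exists st1. Qed.

Lemma crun_cons_some x w st st' : crun (x :: w) st = Some st' ->
  exists2 st1, cstep x st = Some st1 & crun w st1 = Some st'.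
Proof. by rewrite /=; case: cstep => //= st1; exists st1. Qed.

Lemma csub_cat P u v st st' : crun u st = Some st' ->
  csub P (u ++ v) st = csub P u st ++ csub P v st'.
Proof.
elim: u st => [|x u IH] st /= => [[->] //|].
by case: cstep => //= st1 /IH ->; rewrite catA.
Qed.

Lemma csum_cat r u v st st' : crun u st = Some st' ->
  csum r (u ++ v) st = csum r u st + csum r v st'.
Proof.
elim: u st => [|x u IH] st /= => [[->]|]; first by rewrite add0r.
by case: cstep => //= st1 /IH ->; rewrite addrA.
Qed.

(** The two strands of a minimum or maximum share their colour, so they stay or go together; a
    crossing that loses a strand does not change the order of the remaining ones. *)
Lemma csub_run P w st st' : crun w st = Some st' ->
  crun (csub P w st) [seq x <- st | P x.2] = Some [seq x <- st' | P x.2].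
Proof.
elim: w st => [|[i e] w IH] st /=; first by move=> [->].
case E: cstep => [st1|] //= /IH {}IH; rewrite crun_cat.
suff -> : crun (csub1 P (i, e) st) [seq x <- st | P x.2] =
          Some [seq x <- st1 | P x.2] by [].
have [p [s [s' [-> /= -> Es ->]]]] := cstepP E.
rewrite csub1E -size_filter !filter_cat.
case: e s Es {E IH} => [o c||b] [|x [|y s]] //=;
  try by move=> [<-] /=; case: ifP => //= Pc; rewrite cstepE /= ?Pc.
- case: ifP => //= /andP[nxy /eqP xy] [<-]; rewrite xy.
  by case Py: (P y.2) => //=; rewrite cstepE /= nxy xy eqxx.
- by move=> [<-] /=; case Px: (P x.2); case Py: (P y.2) => //=; rewrite cstepE.
Qed.

Lemma crun_colors w st st' : crun w st = Some st' ->
  {subset colors st' <= colors st ++ used w}.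
Proof.
elim: w st => [|[i e] w IH] st /=; first by move=> [->] c; rewrite cats0.
case E: cstep => [st1|] //= /IH {}IH c /IH; rewrite !mem_cat.
have [p [s [s' [-> /= _ Es ->]]]] := cstepP E.
rewrite /colors !map_cat !mem_cat.
case: e s Es {E IH} => [o c'||b] [|x [|y s]] //=;
  try by move=> [<-] /=; rewrite !inE; (do !case: eqP => //=) => *;
    rewrite ?orbT.
- by case: ifP => //= _ [<-] /orP[/orP[|]|] h; rewrite ?inE h ?orbT.
Qed.

Lemma used_cat u v : used (u ++ v) = used u ++ used v.
Proof. exact: pmap_cat. Qed.

Lemma cstep_colors x w st st1 : cstep x st = Some st1 ->
  {subset colors st1 ++ used w <= colors st ++ used (x :: w)}.
Proof.
move=> E c; rewrite [x :: w](_ : _ = [:: x] ++ w) // used_cat !mem_cat.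
have /(_ c) : {subset colors st1 <= colors st ++ used [:: x]}.
  by apply: crun_colors; rewrite /= E.
by rewrite mem_cat => h /orP[/h/orP[|]|] ->; rewrite ?orbT.
Qed.

Lemma csub_ext P1 P2 w st st' : crun w st = Some st' ->
  {in colors st ++ used w, P1 =1 P2} -> csub P1 w st = csub P2 w st.
Proof.
elim: w st => [|[i e] w IH] st //=.
case E: cstep => [st1|] //= hw eqP12.
rewrite (IH _ hw); last by move=> c /(cstep_colors E); apply: eqP12.
congr (_ ++ _).
have [p [s [s' [Est /= -> Es _]]]] := cstepP E.
have eqst : {in st, forall x, P1 x.2 = P2 x.2}.
  by move=> x xs; apply: eqP12; rewrite mem_cat map_f.
rewrite Est !csub1E.
have -> : count (fun y => P1 y.2) p = count (fun y => P2 y.2) p.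
  by apply: eq_in_count => x xp; apply: eqst; rewrite Est mem_cat xp.
have -> // : kept P1 e s = kept P2 e s.
case: e s Es Est eqP12 {E} => [o c'||b] [|x [|y s]] //= _ Est eqP12;
  rewrite ?eqst ?Est ?mem_cat ?inE ?eqxx ?orbT //;
  by apply: eqP12; rewrite mem_cat inE eqxx orbT.
Qed.

Lemma csum_ext r1 r2 w st st' : crun w st = Some st' ->
  {in colors st ++ used w &, r1 =2 r2} -> csum r1 w st = csum r2 w st.
Proof.
elim: w st => [|[i e] w IH] st //=.
case E: cstep => [st1|] //= hw eqP12.
rewrite (IH _ hw); last first.
  by move=> c d /(cstep_colors E) hc /(cstep_colors E) hd; apply: eqP12.
congr (_ + _).
have [p [s [s' [Est /= -> Es _]]]] := cstepP E.
have eqst : {in st &, forall x y, r1 x.2 y.2 = r2 x.2 y.2}.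
  by move=> x y xs ys; apply: eqP12; rewrite mem_cat map_f.
rewrite Est !csignE.
case: e s Es Est eqP12 {E} => [o c'||b] [|x [|y s]] //= _ Est eqP12.
by rewrite eqst ?Est ?mem_cat ?inE ?eqxx ?orbT.
Qed.

End Colored.
Section Recolor.
Variables (T U : eqType) (g : T -> U).

Lemma size_recolor_st (st : cstate T) : size (recolor_st g st) = size st.
Proof. exact: size_map. Qed.

Lemma recolor_st_cat (s t : cstate T) :
  recolor_st g (s ++ t) = recolor_st g s ++ recolor_st g t.
Proof. exact: map_cat. Qed.

Lemma cstep_recolor i e (st st' : cstate T) : cstep (i, e) st = Some st' ->
  cstep (i, recolor_event g e) (recolor_st g st) = Some (recolor_st g st').
Proof.
move=> /cstepP[p [s [s' [-> /= -> Es ->]]]].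
rewrite !recolor_st_cat -(size_recolor_st p) cstepE.
case: e s Es => [o c||b] [|x [|y s]] //=; try by move=> [<-].
by case: ifP => //= /andP[-> /eqP->] [<-]; rewrite eqxx.
Qed.

Lemma crun_recolor w (st st' : cstate T) : crun w st = Some st' ->
  crun (recolor g w) (recolor_st g st) = Some (recolor_st g st').
Proof.
elim: w st => [|[i e] w IH] st /=; first by move=> [->].
by case E: cstep => [st1|] //= /IH {}IH; rewrite (cstep_recolor E).
Qed.

Lemma csub_recolor P w (st st' : cstate T) : crun w st = Some st' ->
  csub P (recolor g w) (recolor_st g st) =
  recolor g (csub (fun c => P (g c)) w st).
Proof.
elim: w st => [|[i e] w IH] st //=.
case E: cstep => [st1|] //= /IH {}IH.
rewrite (cstep_recolor E) /= IH recolor_cat; congr (_ ++ _).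
have [p [s [s' [-> /= -> Es _]]]] := cstepP E.
rewrite !recolor_st_cat -{1}(size_recolor_st p) !csub1E count_map.
by case: e s Es {E} => [o c||b] [|x [|y s]] //= _; case: ifP.
Qed.

Lemma csum_recolor r w (st st' : cstate T) : crun w st = Some st' ->
  csum r (recolor g w) (recolor_st g st) =
  csum (fun c d => r (g c) (g d)) w st.
Proof.
elim: w st => [|[i e] w IH] st //=.
case E: cstep => [st1|] //= /IH {}IH.
rewrite (cstep_recolor E) /= IH; congr (_ + _).
have [p [s [s' [-> /= -> Es _]]]] := cstepP E.
rewrite !recolor_st_cat -{1}(size_recolor_st p) !csignE.
by case: e s Es {E} => [o c||b] [|x [|y s]].
Qed.

Lemma used_recolor w : used (recolor g w) = map g (used w).
Proof. by elim: w => //= -[i [o c||b]] w ->. Qed.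

End Recolor.

(** * Parity of numbers of pairs of colours *)

Section Parity.

(** Meant for two colourings of the same word, run in parallel and compared position by position. *)
Definition pair_count (T U : eqType) (a : T) (c : U) st st' : nat :=
  count (fun x : (bool * T) * (bool * U) => (x.1.2 == a) && (x.2.2 == c))
    (zip st st').

(** A minimum adds, and a maximum removes, two adjacent positions with the same pair of colours; a
    crossing only permutes positions. *)
Lemma cstep_pair_parity (T U : eqType) (a : T) (c : U) x y st1 st2 st1' st2' :
  plain x = plain y -> size st1 = size st2 ->
  cstep x st1 = Some st1' -> cstep y st2 = Some st2' ->
  size st1' = size st2' /\
  odd (pair_count a c st1 st2) = odd (pair_count a c st1' st2').
Proof.
case: x y => [i e] [j f] [<- ef] sz.
move=> /cstepP[p [s [s' [Est1 /= Ei Es ->]]]].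
move=> /cstepP[p2 [s2 [s2' [Est2 /= Ei2 Es2 ->]]]].
have sp : size p = size p2 by rewrite -Ei.
move: sz; rewrite Est1 Est2 !size_cat -sp => /addnI ss {Est1 Est2}.
rewrite /pair_count !zip_cat // !count_cat !oddD.
case: e ef Es => [o d||b]; case: f Es2 => [o' d'||b'] //=.
- move=> [<-] _ [<-] /=; rewrite ss; split=> //.
  by congr (_ (+) _); case: (_ && _); rewrite //= negbK.
- case: s ss => [|x1 [|y1 s]]; case: s2 => [|x2 [|y2 s2]] //= [ss].
  case: ifP => // /andP[_ /eqP exy2] [<-] _; case: ifP => // /andP[_ /eqP exy1] [<-].
  rewrite ss; split=> //; congr (_ (+) _).
  by rewrite exy1 exy2; case: (_ && _); rewrite //= negbK.
- case: s ss => [|x1 [|y1 s]]; case: s2 => [|x2 [|y2 s2]] //= [ss] [<-] _ [<-] /=.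
  by rewrite ss; split=> //; congr (_ (+) _); rewrite !oddD !addbA (addbC (odd _)).
Qed.

Lemma crun_pair_parity (T U : eqType) (a : T) (c : U) u v st1 st2 st1' st2' :
  plainw u = plainw v -> size st1 = size st2 ->
  crun u st1 = Some st1' -> crun v st2 = Some st2' ->
  size st1' = size st2' /\
  odd (pair_count a c st1 st2) = odd (pair_count a c st1' st2').
Proof.
elim: u v st1 st2 => [|x u IH] [|y v] st1 st2 //=.
  by move=> _ sz [<-] [<-].
move=> [e1 e2 e3] sz.
case E1: cstep => [s1|] //= r1; case E2: cstep => [s2|] //= r2.
have exy : plain x = plain y by rewrite /plain e1 e2.
have [sz1 ->] := cstep_pair_parity a c exy sz E1 E2.
exact: IH e3 sz1 r1 r2.
Qed.

Variables (T : eqType) (a b : T).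

(* The parity of the number of pairs (a, b) met from left to right changes
   exactly at the crossings between a and b. *)
Fixpoint inversions (st : cstate T) : nat :=
  if st is x :: s
  then ((x.2 == a) * count (fun y => y.2 == b) s + inversions s)%N else 0.

Lemma inversions_cat s t : inversions (s ++ t) =
  (inversions s + inversions t
   + count (fun y => y.2 == a) s * count (fun y => y.2 == b) t)%N.
Proof.
elim: s => [|x s IH] /=; first by rewrite add0n mul0n addn0.
by rewrite IH count_cat; case: (x.2 == a); lia.
Qed.

Definition between : rel T :=
  fun c d => (c == a) && (d == b) || (c == b) && (d == a).

(** The two ends of a minimum or maximum have one colour, which is not both [a] and [b], so they
    change the number of inversions by an even number; a crossing between [a] and [b] changes it by
    one. Modulo 2, the sum of the two counts stands for their difference. *)
Lemma cstep_inversions x st st' : a != b -> cstep x st = Some st' ->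
  (2 %| csign between x st + (inversions st)%:Z + (inversions st')%:Z)%Z.
Proof.
move=> nab; case: x => [i e] /cstepP[p [s [s' [-> /= -> Es ->]]]].
rewrite csignE !inversions_cat.
case: e Es => [o c [<-]||d]; first by rewrite /=;
    have [->|] := eqVneq c a; rewrite ?(negPf nab) ?eqxx; lia.
- case: s => [|x [|y s]] //=; case: ifP => // /andP[_ /eqP ->] [<-].
  by have [->|] := eqVneq y.2 a; rewrite ?(negPf nab) ?eqxx; lia.
- case: s => [|x [|y s]] //= [<-] /=; rewrite /between.
  have nx z : ~~ ((z == a) && (z == b)).
    by apply: contra nab => /andP[/eqP<-].
  move: (nx x.2) (nx y.2); case: (d == _).
    by case: (x.2 == a); case: (x.2 == b); case: (y.2 == a);
       case: (y.2 == b) => //= _ _; lia.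
  by case: (x.2 == a); case: (x.2 == b); case: (y.2 == a);
     case: (y.2 == b) => //= _ _; lia.
Qed.

(** Between empty levels both inversion counts vanish: the signed count is even, and the division in
    [linking_number] is exact. *)
Lemma csum_between_even w st st' : a != b -> crun w st = Some st' ->
  (2 %| csum between w st + (inversions st)%:Z + (inversions st')%:Z)%Z.
Proof.
move=> nab; elim: w st => [|x w IH] st /=; first by move=> [->]; lia.
case E: cstep => [st1|] //= /IH; have := cstep_inversions nab E; lia.
Qed.

End Parity.

(** * Transport of colourings along local moves *)

Definition paint (T : Type) (c : T) (x : slice) : cslice T :=
  (x.1, match x.2 with
        | Cup o => CCup o c | Cap => CCap | Cross b => CCross b end).

Lemma plain_paint (T : Type) (c : T) x : plain (paint c x) = x.
Proof. by case: x => i []. Qed.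

(** With a single colour only the directions can block a run, so validity of [mono w] expresses that
    a nonempty [w] is a diagram; see [diagramE]. *)
Definition mono (w : word) : cword unit := map (paint tt) w.

Lemma mono_plainw (T : Type) (w : cword T) :
  mono (plainw w) = recolor (fun=> tt) w.
Proof. by elim: w => //= -[i [o c||b]] w ->. Qed.

Lemma plain_mono w : plainw (mono w) = w.
Proof. by elim: w => //= x w ->; rewrite plain_paint. Qed.

Lemma mono_cat u v : mono (u ++ v) = mono u ++ mono v.
Proof. exact: map_cat. Qed.

Definition shiftw (A : Type) (k : nat) : seq (nat * A) -> seq (nat * A) :=
  map (fun x => ((k + x.1)%N, x.2)).

Lemma shiftw_cat (A : Type) k (u v : seq (nat * A)) :
  shiftw k (u ++ v) = shiftw k u ++ shiftw k v.
Proof. exact: map_cat. Qed.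

Lemma plainw_shiftw (T : Type) k (w : cword T) :
  plainw (shiftw k w) = shiftw k (plainw w).
Proof. by elim: w => //= x w ->. Qed.

Lemma used_shiftw (T : eqType) k (w : cword T) : used (shiftw k w) = used w.
Proof. by elim: w => //= x w ->. Qed.

Lemma mono_shiftw k w : mono (shiftw k w) = shiftw k (mono w).
Proof. by elim: w => //= x w ->. Qed.

Lemma plainw_shiftw_inv (T : Type) k (w : cword T) a :
  plainw w = shiftw k a -> exists2 w0, w = shiftw k w0 & plainw w0 = a.
Proof.
elim: w a => [|[i e] w IH] [|[j f] a] //=; first by exists [::].
move=> [-> <- /IH[w0 -> <-]]; exists ((j, e) :: w0) => //.
Qed.

Section Shift.
Variable T : eqType.
Implicit Types (w : cword T) (p s : cstate T).

Lemma crun_shiftw p s w :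
  crun (shiftw (size p) w) (p ++ s) = omap (cat p) (crun w s).
Proof.
elim: w s => [|[i e] w IH] s //=.
by rewrite cstep_cat; case: cstep => //= s1.
Qed.

Lemma crun_shiftw_size k w st st' : (0 < size w)%N ->
  crun (shiftw k w) st = Some st' -> (k <= size st)%N.
Proof.
case: w => //= -[i e] w _; rewrite /cstep /=; case: ifP => // le_ki _.
exact: leq_trans (leq_addr i k) le_ki.
Qed.

Lemma csub_shiftw P p s s' w : crun w s = Some s' ->
  csub P (shiftw (size p) w) (p ++ s) =
  shiftw (count (fun y => P y.2) p) (csub P w s).
Proof.
elim: w s => [|[i e] w IH] s //=.
case E: cstep => [s1|] //= /IH {}IH.
rewrite cstep_cat E /= IH shiftw_cat; congr (_ ++ _).
have [t [s0 [s0' [-> /= -> _ _]]]] := cstepP E.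
rewrite catA -size_cat !csub1E; case: ifP => //= _.
by rewrite count_cat.
Qed.

Lemma csum_shiftw r p s s' w : crun w s = Some s' ->
  csum r (shiftw (size p) w) (p ++ s) = csum r w s.
Proof.
elim: w s => [|[i e] w IH] s //=.
case E: cstep => [s1|] //= /IH {}IH.
rewrite cstep_cat E /= IH; congr (_ + _).
have [t [s0 [s0' [-> /= -> _ _]]]] := cstepP E.
by rewrite catA -size_cat !csignE.
Qed.

End Shift.

Lemma local_move_shiftw k a b :
  local_move a b -> local_move (shiftw k a) (shiftw k b).
Proof.
by case=> /= *; rewrite ?addnS ?addnA; constructor.
Qed.

(** Equality is included because erasing strands can remove the difference between the two sides of
    a move. *)
Definition moves (a b : word) : Prop :=
  a = b \/ local_move a b \/ local_move b a.

Lemma moves_sym a b : moves a b -> moves b a.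
Proof. by case=> [->|[h|h]]; [left|right; right|right; left]. Qed.

Lemma moves_shiftw k a b : moves a b -> moves (shiftw k a) (shiftw k b).
Proof.
by case=> [->|[h|h]]; [left|right; left|right; right]; try exact: local_move_shiftw.
Qed.

(** The inclusions mention [colors st] because a move can create or remove a minimum whose colour is
    that of a strand already present. Symmetry of [r] serves the moves that exchange left and right
    at a crossing, irreflexivity the kinks, where a strand crosses itself. *)
Definition equivalent_at (T : eqType) (ca cb : cword T) (st : cstate T) : Prop :=
  [/\ {subset used ca <= colors st ++ used cb},
      {subset used cb <= colors st ++ used ca},
      forall r, symmetric r -> irreflexive r -> csum r cb st = csum r ca st
    & forall P, moves (plainw (csub P ca st)) (plainw (csub P cb st))].

(* The last hypothesis forces the directions of the minima of b, and provides
   the strands on which b acts when a is empty. *)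
Definition transports (a b : word) : Prop :=
  forall (T : eqType) (ca : cword T) (st st' : cstate T),
  plainw ca = a -> crun ca st = Some st' ->
  isSome (crun (mono b) (recolor_st (fun=> tt) st)) ->
  exists cb, [/\ plainw cb = b, crun cb st = Some st' & equivalent_at ca cb st].

Lemma transports_shiftw k a b : (0 < size a + size b)%N ->
  transports a b -> transports (shiftw k a) (shiftw k b).
Proof.
move=> nab tab T ca0 st st' /plainw_shiftw_inv[ca -> Eca] ra.
rewrite mono_shiftw => rb.
(* One side of the move is nonempty and can be run, so the level has at least [k] strands and a
   prefix of length [k] can be split off. *)
have kst : (k <= size st)%N.
  move: nab; rewrite addn_gt0 => /orP[na|nb].
    by apply: crun_shiftw_size ra; rewrite -(size_map (@plain T)) -/(plainw ca) Eca.
  case E : crun rb => [s|] // _; rewrite -(size_recolor_st (fun=> tt)).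
  by apply: crun_shiftw_size E; rewrite size_map.
have [p [s [Est Ek]]] : exists p s, st = p ++ s /\ k = size p.
  by exists (take k st), (drop k st); rewrite cat_take_drop size_takel.
move: ra rb; rewrite {kst}Ek Est recolor_st_cat -(size_recolor_st (fun=> tt) p).
rewrite crun_shiftw size_recolor_st crun_shiftw.
case Ea: crun => [s'|] //= [<-]; case Eb: crun => [sb|] //= _.
have [] := tab T ca s s' Eca Ea; first by rewrite Eb.
move=> cb [Ecb rb [u1 u2 cs sub]]; exists (shiftw (size p) cb).
split; rewrite ?plainw_shiftw ?Ecb ?crun_shiftw ?rb //; split.
- move=> c; rewrite !used_shiftw => /u1.
  by rewrite /colors map_cat !mem_cat => /orP[->|->]; rewrite ?orbT.
- move=> c; rewrite !used_shiftw => /u2.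
  by rewrite /colors map_cat !mem_cat => /orP[->|->]; rewrite ?orbT.
- by move=> r rs ri; rewrite !(csum_shiftw _ _ Ea, csum_shiftw _ _ rb) cs.
- move=> P; rewrite (csub_shiftw _ _ Ea) (csub_shiftw _ _ rb) !plainw_shiftw.
  exact: moves_shiftw.
Qed.

Section Positions.
Variable T : eqType.
Implicit Types (s : cstate T) (e : cevent T).

Lemma cstep0 e s : cstep (0%N, e) s = act e s.
Proof. by rewrite -[s in LHS]cat0s (cstepE [::]); case: act. Qed.

Lemma cstep1 e x s : cstep (1%N, e) (x :: s) = omap (cons x) (act e s).
Proof. exact: (cstepE [:: x]). Qed.

Lemma cstep1_nil e : cstep (1%N, e) [::] = None.
Proof. by []. Qed.

Lemma csub10 P e s :
  csub1 P (0%N, e) s = if kept P e s then [:: (0%N, e)] else [::].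
Proof. exact: (csub1E P [::]). Qed.

Lemma csub11 P e x s :
  csub1 P (1%N, e) (x :: s) =
  if kept P e s then [:: (P x.2 : nat, e)] else [::].
Proof. by rewrite (csub1E P [:: x]) /= addn0. Qed.

Lemma csign0 r e s : csign r (0%N, e) s = act_sign r e s.
Proof. exact: (csignE r [::]). Qed.

Lemma csign1 r e x s : csign r (1%N, e) (x :: s) = act_sign r e s.
Proof. exact: (csignE r [:: x]). Qed.

Lemma csub1_cat P (p : cstate T) s i e :
  csub1 P ((size p + i)%N, e) (p ++ s) =
  shiftw (count (fun y => P y.2) p) (csub1 P (i, e) s).
Proof.
rewrite /csub1 /= drop_cat take_cat ltnNge leq_addr /= addKn.
by case: ifP => //= _; rewrite count_cat.
Qed.

Lemma csign_cat r (p : cstate T) s i e :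
  csign r ((size p + i)%N, e) (p ++ s) = csign r (i, e) s.
Proof. by rewrite /csign /= drop_cat ltnNge leq_addr /= addKn. Qed.

Lemma csub1_def P x s : csub1 P x s =
  if kept P x.2 (drop x.1 s)
  then [:: (count (fun y => P y.2) (take x.1 s), x.2)] else [::].
Proof. by []. Qed.

Lemma csign_def r x s : csign r x s = act_sign r x.2 (drop x.1 s).
Proof. by []. Qed.

Definition posE := (cstep0, cstep1, cstep1_nil, csub10, csub11, csign0, csign1).
End Positions.

(* [simpl] would unfold these under a match, in spite of [simpl never]. *)
Opaque cstep csub1 csign.



Ltac cstep_simpl := rewrite /= ?posE /= ?posE /= ?posE /=.

Ltac solve_subset :=
  let c := fresh in intro c; rewrite /= ?(mem_cat, in_cons, in_nil);
  repeat match goal with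
    | |- context [c == ?d] => case: (c == d)
    | |- context [c \in ?d] => case: (c \in d)
    end; done.

(** The maximum forces the minimum to have the colour of the strand passing through. Erasing colours
    then keeps the whole zigzag, and the move applies, or removes all of it, and both sides are
    empty. *)
Lemma transports_zigzag_right o :
  transports [:: (1, Cup o); (0, Cap)]%N [::] /\
  transports [::] [:: (1, Cup o); (0, Cap)]%N.
Proof.
split=> T.
  case=> [|[i1 e1] [|[i2 e2] [|? ?]]] //= st st' [-> E1 -> E2].
  case: e1 E1 => // _ c [->]; case: e2 E2 => // _ {i1 i2}.
  case: st => [|x s]; cstep_simpl => //; case: ifP => //= /andP[h1 /eqP<-].
  move=> [<-] _; exists [::]; split=> //=.
    by case: x h1 => [d1 c1] /=; case: d1; case: (o).
  split=> /=; [solve_subset|solve_subset|by move=> r rs ri; cstep_simpl|].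
  move=> P; cstep_simpl; case: (P x.2); cstep_simpl; last by left.
  by right; left; apply: (move_zigzag_right 0).
case=> //= st _ _ [<-].
case: st => [|x s]; cstep_simpl => //; rewrite andbT; case: ifP => //= ox _.
(* The maximum accepts no other colour for the new minimum; [ox] says that its direction [o]
   fits. *)
exists [:: (1%N, CCup o x.2); (0%N, CCap)]; split; first by [].
  by cstep_simpl; rewrite ox eqxx; case: x ox => -[] c; case: (o).
split=> /=; [solve_subset|solve_subset|by move=> r rs ri; cstep_simpl|].
move=> P; cstep_simpl; case: (P x.2); cstep_simpl; last by left.
by right; right; apply: (move_zigzag_right 0).
Qed.

Lemma transports_zigzag_left o :
  transports [:: (0, Cup o); (1, Cap)]%N [::] /\
  transports [::] [:: (0, Cup o); (1, Cap)]%N.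
Proof.
split=> T.
  case=> [|[i1 e1] [|[i2 e2] [|? ?]]] //= st st' [-> E1 -> E2].
  case: e1 E1 => // _ c [->]; case: e2 E2 => // _ {i1 i2}.
  case: st => [|x s]; cstep_simpl => //; case: ifP => //= /andP[h1 /eqP->].
  move=> [<-] _; exists [::]; split=> //=.
    by case: x h1 => [d1 c1] /=; case: d1; case: (o).
  split=> /=; [solve_subset|solve_subset|by move=> r rs ri; cstep_simpl|].
  move=> P; cstep_simpl; case: (P x.2); cstep_simpl; last by left.
  by right; left; apply: (move_zigzag_left 0).
case=> //= st _ _ [<-].
case: st => [|x s]; cstep_simpl => //; rewrite andbT; case: ifP => //= ox _.
exists [:: (0%N, CCup o x.2); (1%N, CCap)]; split; first by [].
  by cstep_simpl; rewrite ox eqxx; case: x ox => -[] c; case: (o).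
split=> /=; [solve_subset|solve_subset|by move=> r rs ri; cstep_simpl|].
move=> P; cstep_simpl; case: (P x.2); cstep_simpl; last by left.
by right; right; apply: (move_zigzag_left 0).
Qed.

Lemma transports_slide_cup o b :
  transports [:: (1, Cup o); (0, Cross b)]%N
             [:: (0, Cup o); (1, Cross (~~ b))]%N /\
  transports [:: (0, Cup o); (1, Cross (~~ b))]%N
             [:: (1, Cup o); (0, Cross b)]%N.
Proof.
split=> T.
  case=> [|[i1 e1] [|[i2 e2] [|? ?]]] //= st st' [-> E1 -> E2].
  case: e1 E1 => // _ c [->]; case: e2 E2 => // _ [->] {i1 i2}.
  case: st => [|x s]; cstep_simpl => // -[<-] _.
  exists [:: (0%N, CCup o c); (1%N, CCross (~~ b))]; split; first by [].
    by cstep_simpl.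
  split=> /=; [solve_subset|solve_subset| |].
    (* After the slide, [x] meets the other branch of the minimum, which has the opposite direction,
       and the bit of the crossing is flipped too: the sign is unchanged. The two colours are met in
       the reverse order, hence the symmetry. *)
    move=> r rs ri; cstep_simpl; rewrite rs.
    by case: (r _ _); case: x.1; case: (o); case: (b).
  move=> P; cstep_simpl; case: (P x.2); case: (P c); cstep_simpl; try by left.
  by right; left; apply: (move_slide_cup 0).
case=> [|[i1 e1] [|[i2 e2] [|? ?]]] //= st st' [-> E1 -> E2].
case: e1 E1 => // _ c [->]; case: e2 E2 => // _ [->] {i1 i2}.
case: st => [|x s]; cstep_simpl => // -[<-] _.
exists [:: (1%N, CCup o c); (0%N, CCross b)]; split; first by [].
  by cstep_simpl.
split=> /=; [solve_subset|solve_subset| |].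
  move=> r rs ri; cstep_simpl; rewrite rs.
  by case: (r _ _); case: x.1; case: (o); case: (b).
move=> P; cstep_simpl; case: (P x.2); case: (P c); cstep_simpl; try by left.
by right; right; apply: (move_slide_cup 0).
Qed.

Lemma transports_slide_cap b :
  transports [:: (0, Cross b); (1, Cap)]%N
             [:: (1, Cross (~~ b)); (0, Cap)]%N /\
  transports [:: (1, Cross (~~ b)); (0, Cap)]%N
             [:: (0, Cross b); (1, Cap)]%N.
Proof.
split=> T.
  case=> [|[i1 e1] [|[i2 e2] [|? ?]]] //= st st' [-> E1 -> E2].
  case: e1 E1 => // _ [->]; case: e2 E2 => // _ {i1 i2}.
  case: st => [|x [|y [|z s]]]; cstep_simpl => //.
  case: ifP => //= /andP[h1 /eqP h2] [<-] _.
  exists [:: (1%N, CCross (~~ b)); (0%N, CCap)]; split; first by [].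
    by cstep_simpl; rewrite h1 h2 eqxx.
  split=> /=; [solve_subset|solve_subset| |].
    move=> r rs ri; cstep_simpl; rewrite h2 rs.
    by case: (r _ _) => //; case: x.1 h1; case: y.1; case: z.1; case: (b).
  move=> P; cstep_simpl; rewrite h2.
  case: (P y.2); case: (P z.2); cstep_simpl; try by left.
  by right; left; apply: (move_slide_cap 0).
case=> [|[i1 e1] [|[i2 e2] [|? ?]]] //= st st' [-> E1 -> E2].
case: e1 E1 => // _ [->]; case: e2 E2 => // _ {i1 i2}.
case: st => [|x [|y [|z s]]]; cstep_simpl => //.
case: ifP => //= /andP[h1 /eqP h2] [<-] _.
exists [:: (0%N, CCross b); (1%N, CCap)]; split; first by [].
  by cstep_simpl; rewrite h1 h2 eqxx.
split=> /=; [solve_subset|solve_subset| |].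
  move=> r rs ri; cstep_simpl; rewrite h2 rs.
  by case: (r _ _) => //; case: x.1 h1; case: y.1; case: z.1; case: (b).
move=> P; cstep_simpl; rewrite h2.
case: (P y.2); case: (P z.2); cstep_simpl; try by left.
by right; right; apply: (move_slide_cap 0).
Qed.

Lemma transports_R1_right o b :
  transports [:: (1, Cup o); (0, Cross b); (1, Cap)]%N [::] /\
  transports [::] [:: (1, Cup o); (0, Cross b); (1, Cap)]%N.
Proof.
split=> T.
  case=> [|[i1 e1] [|[i2 e2] [|[i3 e3] [|? ?]]]] //= st st' [-> E1 -> E2 -> E3].
  case: e1 E1 => // _ c [->]; case: e2 E2 => // _ [->]; case: e3 E3 => // _.
  case: st => [|x s]; cstep_simpl => //; case: ifP => //= /andP[h1 /eqP <-].
  move=> [<-] _; exists [::]; split=> //=.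
    by case: x h1 => [d1 c1] /=; case: d1; case: (o).
  split=> /=; [solve_subset|solve_subset| |].
    by move=> r rs ri; cstep_simpl; rewrite ri.
  move=> P; cstep_simpl; case: (P x.2); cstep_simpl; last by left.
  by right; left; apply: (move_R1_right 0).
case=> //= st _ _ [<-].
case: st => [|x s]; cstep_simpl => //; rewrite andbT; case: ifP => //= ox _.
exists [:: (1, CCup o x.2); (0, CCross b); (1, CCap)]%N; split; first by [].
  by cstep_simpl; rewrite ox eqxx; case: x ox => -[] c; case: (o).
split=> /=; [solve_subset|solve_subset| |].
  by move=> r rs ri; cstep_simpl; rewrite ri.
move=> P; cstep_simpl; case: (P x.2); cstep_simpl; last by left.
by right; right; apply: (move_R1_right 0).
Qed.

Lemma transports_R1_left o b :
  transports [:: (0, Cup o); (1, Cross b); (0, Cap)]%N [::] /\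
  transports [::] [:: (0, Cup o); (1, Cross b); (0, Cap)]%N.
Proof.
split=> T.
  case=> [|[i1 e1] [|[i2 e2] [|[i3 e3] [|? ?]]]] //= st st' [-> E1 -> E2 -> E3].
  case: e1 E1 => // _ c [->]; case: e2 E2 => // _ [->]; case: e3 E3 => // _.
  case: st => [|x s]; cstep_simpl => //; case: ifP => //= /andP[h1 /eqP ->].
  move=> [<-] _; exists [::]; split=> //=.
    by case: x h1 => [d1 c1] /=; case: d1; case: (o).
  split=> /=; [solve_subset|solve_subset| |].
    by move=> r rs ri; cstep_simpl; rewrite ri.
  move=> P; cstep_simpl; case: (P x.2); cstep_simpl; last by left.
  by right; left; apply: (move_R1_left 0).
case=> //= st _ _ [<-].
case: st => [|x s]; cstep_simpl => //; rewrite andbT; case: ifP => //= ox _.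
exists [:: (0, CCup o x.2); (1, CCross b); (0, CCap)]%N; split; first by [].
  by cstep_simpl; rewrite ox eqxx; case: x ox => -[] c; case: (o).
split=> /=; [solve_subset|solve_subset| |].
  by move=> r rs ri; cstep_simpl; rewrite ri.
move=> P; cstep_simpl; case: (P x.2); cstep_simpl; last by left.
by right; right; apply: (move_R1_left 0).
Qed.

Lemma transports_R2 b :
  transports [:: (0, Cross b); (0, Cross (~~ b))]%N [::] /\
  transports [::] [:: (0, Cross b); (0, Cross (~~ b))]%N.
Proof.
split=> T.
  case=> [|[i1 e1] [|[i2 e2] [|? ?]]] //= st st' [-> E1 -> E2].
  case: e1 E1 => // _ [->]; case: e2 E2 => // _ [->].
  case: st => [|x [|y s]]; cstep_simpl => // -[<-] _.
  exists [::]; split=> //=.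
  split=> /=; [solve_subset|solve_subset| |].
    move=> r rs ri; cstep_simpl; rewrite rs.
    by case: (r _ _); case: x.1; case: y.1; case: (b).
  move=> P; cstep_simpl; case: (P x.2); case: (P y.2); cstep_simpl; try by left.
  by right; left; apply: (move_R2 0).
case=> //= st _ _ [<-].
case: st => [|x [|y s]]; cstep_simpl => // _.
exists [:: (0, CCross b); (0, CCross (~~ b))]%N; split; first by [].
  by cstep_simpl.
split=> /=; [solve_subset|solve_subset| |].
  move=> r rs ri; cstep_simpl; rewrite rs.
  by case: (r _ _); case: x.1; case: y.1; case: (b).
move=> P; cstep_simpl; case: (P x.2); case: (P y.2); cstep_simpl; try by left.
by right; right; apply: (move_R2 0).
Qed.

(** The same three pairs of strands cross on both sides. If a strand is erased, at most one crossing
    remains, at the same place on both sides; the move itself is needed only when all three strands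
    are kept. *)
Lemma transports_R3 b c d : ~~ ((b == d) && (c != b)) ->
  transports [:: (0, Cross b); (1, Cross c); (0, Cross d)]%N
             [:: (1, Cross d); (0, Cross c); (1, Cross b)]%N /\
  transports [:: (1, Cross d); (0, Cross c); (1, Cross b)]%N
             [:: (0, Cross b); (1, Cross c); (0, Cross d)]%N.
Proof.
move=> nc; split=> T.
  case=> [|[i1 e1] [|[i2 e2] [|[i3 e3] [|? ?]]]] //= st st' [-> E1 -> E2 -> E3].
  case: e1 E1 => // _ [->]; case: e2 E2 => // _ [->]; case: e3 E3 => // _ [->].
  case: st => [|x [|y [|z s]]]; cstep_simpl => // -[<-] _.
  exists [:: (1, CCross d); (0, CCross c); (1, CCross b)]%N; split; first by [].
    by cstep_simpl.
  split=> /=; [solve_subset|solve_subset| |].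
    by move=> r rs ri; cstep_simpl; lia.
  move=> P; cstep_simpl; case: (P x.2); case: (P y.2); case: (P z.2);
    cstep_simpl; try by left.
  by right; left; apply: (move_R3 0).
case=> [|[i1 e1] [|[i2 e2] [|[i3 e3] [|? ?]]]] //= st st' [-> E1 -> E2 -> E3].
case: e1 E1 => // _ [->]; case: e2 E2 => // _ [->]; case: e3 E3 => // _ [->].
case: st => [|x [|y [|z s]]]; cstep_simpl => // -[<-] _.
exists [:: (0, CCross b); (1, CCross c); (0, CCross d)]%N; split; first by [].
  by cstep_simpl.
split=> /=; [solve_subset|solve_subset| |].
  by move=> r rs ri; cstep_simpl; lia.
move=> P; cstep_simpl; case: (P x.2); case: (P y.2); case: (P z.2);
  cstep_simpl; try by left.
by right; right; apply: (move_R3 0).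
Qed.

(** Isolates what an event touches: inputs [h] become outputs [h'], the rest [m] is ignored. The
    last clause controls positions further right: either the event survives with all of its strands,
    or equally many strands are kept below and above it. *)
Lemma act_local (T : eqType) (e : cevent T) s s1 : act e s = Some s1 ->
  exists h h' m, [/\ s = h ++ m, s1 = h' ++ m,
    size h = inputs (plain (0%N, e)).2, size h' = outputs (plain (0%N, e)).2
    & [/\ forall m', act e (h ++ m') = Some (h' ++ m'),
        forall P m', kept P e (h ++ m') = kept P e h,
        forall r m', act_sign r e (h ++ m') = act_sign r e h
      & forall P : pred T, let n := count (fun y => P y.2) in
        if kept P e h then n h = size h /\ n h' = size h' else n h = n h']].
Proof.
case: e s => [o c||b] [|x [|y s]] //=.
- move=> [<-]; exists [::], [:: (o, c); (~~ o, c)], [::]; split=> //; split=> // P /=.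
  by case: ifP => [->|->].
- move=> [<-]; exists [::], [:: (o, c); (~~ o, c)], [:: x]; split=> //; split=> // P /=.
  by case: ifP => [->|->].
- move=> [<-]; exists [::], [:: (o, c); (~~ o, c)], [:: x, y & s]; split=> //.
  by split=> // P /=; case: ifP => [->|->].
- case: ifP => //= /andP[h1 /eqP h2] [<-]; exists [:: x; y], [::], s.
  split=> //; split=> //= [m'|P]; first by rewrite h1 h2 eqxx.
  by rewrite h2 andbb; case: ifP => // ->.
- move=> [<-]; exists [:: x; y], [:: y; x], s; split=> //; split=> //= P.
  by case: (P x.2); case: (P y.2).
Qed.

Lemma used2C (T : eqType) (x y : cslice T) : used [:: x; y] =i used [:: y; x].
Proof. by move=> c; rewrite (used_cat [:: x]) mem_cat orbC -mem_cat -used_cat. Qed.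

(** If both events survive an erasure, the position of the right one still differs by [inputs] and
    [outputs], and the move applies. If one is erased, the other lands at the same position on both
    sides. *)
Lemma transports_commute d e f :
  transports [:: (0, e); (outputs e + d, f)]%N
             [:: (inputs e + d, f); (0, e)]%N /\
  transports [:: (inputs e + d, f); (0, e)]%N
             [:: (0, e); (outputs e + d, f)]%N.
Proof.
have subP (T : eqType) (ce cf : cevent T) (h h' m m2 : cstate T) :
    (plain (0%N, ce)).2 = e -> (plain (0%N, cf)).2 = f ->
    size h = inputs e -> size h' = outputs e ->
    (forall P m', kept P ce (h ++ m') = kept P ce h) ->
    (forall P : pred T, let n := count (fun y => P y.2) in
        if kept P ce h then n h = size h /\ n h' = size h' else n h = n h') ->
    forall P, moves
      (plainw (csub1 P (0%N, ce) (h ++ m) ++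
               csub1 P ((size h' + d)%N, cf) (h' ++ m)))
      (plainw (csub1 P ((size h + d)%N, cf) (h ++ m) ++
               csub1 P (0%N, ce) (h ++ m2))).
  move=> Ee Ef sh sh' K C P; rewrite !csub1_cat !csub10 !K.
  have := C P; case: ifP => /= [_ [-> ->]|_ ->]; last by left; rewrite cats0.
  rewrite csub1_def; case: ifP => /= _; last by left.
  rewrite sh sh' -Ee; right; left.
  exact: (move_commute 0).
split=> T.
  case=> [|[i1 e1] [|[i2 e2] [|? ?]]] //= st st' [-> E1 -> E2].
  case S1: cstep => [s1|] //=; case S2: cstep => [s2|] //= [<-] _.
  move: S1; rewrite posE => /act_local[h [h' [m [Eh Eh' sh sh' [A K G C]]]]].
  rewrite [(plain _).2]E1 in sh sh'.
  move: S2; rewrite Eh' -sh' cstep_cat; case S2: cstep => [m2|] //= [<-].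
  exists [:: ((size h + d)%N, e2); (0%N, e1)].
  split=> /=; first by rewrite sh -E1 -E2.
    by rewrite Eh cstep_cat S2 /= posE A.
  split.
  - by move=> c; rewrite used2C => H; rewrite mem_cat H orbT.
  - by move=> c; rewrite used2C => H; rewrite mem_cat H orbT.
  - move=> r rs ri /=; rewrite Eh !posE A /= !csign_cat cstep_cat S2 /= !G.
    by rewrite addr0 addrC addr0.
  - move=> P /=; rewrite Eh cstep0 A /= cstep_cat S2 /= !cats0.
    exact: subP.
case=> [|[i1 e1] [|[i2 e2] [|? ?]]] //= st st' [-> E1 -> E2].
case S1: cstep => [s1|] //=; case S2: cstep => [s2|] //= [<-] _.
have [h [m [Eh sh]]] : exists h m, st = h ++ m /\ size h = inputs e.
  exists (take (inputs e) st), (drop (inputs e) st); rewrite cat_take_drop.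
  split=> //; rewrite size_takel //.
  have [p [s [_ [-> /= Ep _ _]]]] := cstepP S1.
  by rewrite size_cat -Ep -addnA leq_addr.
move: S1; rewrite Eh -sh cstep_cat; case S1: cstep => [m2|] //= [Es1].
move: S2; rewrite posE => /act_local[h2 [h' [m3 [Eh2 Es2 sh2 sh' [A K G C]]]]].
rewrite [(plain _).2]E2 in sh2 sh'.
have [? ?] : h = h2 /\ m2 = m3.
  by move/eqP: Eh2; rewrite -Es1 eqseq_cat ?sh ?sh2 // => /andP[/eqP-> /eqP->].
subst h2 m3; exists [:: (0%N, e2); ((size h' + d)%N, e1)].
split=> /=; first by rewrite sh' -E1 -E2.
  by rewrite !posE A /= cstep_cat S1 /= Es2.
split.
- by move=> c; rewrite used2C => H; rewrite mem_cat H orbT.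
- by move=> c; rewrite used2C => H; rewrite mem_cat H orbT.
- move=> r rs ri /=; rewrite !posE A /= !csign_cat cstep_cat S1 /= !G.
  by rewrite addr0 addrC addr0.
- move=> P /=; rewrite cstep0 A /= cstep_cat S1 /= !cats0.
  by apply: moves_sym; apply: subP.
Qed.

Lemma local_move_transports a b :
  local_move a b -> transports a b /\ transports b a.
Proof.
have shiftP k a0 b0 : transports a0 b0 /\ transports b0 a0 ->
    (0 < size a0 + size b0)%N -> transports (shiftw k a0) (shiftw k b0) /\
    transports (shiftw k b0) (shiftw k a0).
  by move=> [h1 h2] h; split; apply: transports_shiftw; rewrite // addnC.
case=> i.
- move=> d e f; have /(_ isT) := @shiftP i _ _ (transports_commute d e f).
  by rewrite /= !addn0 !addnA.
- move=> o; have /(_ isT) := @shiftP i _ _ (transports_zigzag_right o).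
  by rewrite /= addn0 addn1.
- move=> o; have /(_ isT) := @shiftP i _ _ (transports_zigzag_left o).
  by rewrite /= addn0 addn1.
- move=> o b0; have /(_ isT) := @shiftP i _ _ (transports_slide_cup o b0).
  by rewrite /= addn0 addn1.
- move=> b0; have /(_ isT) := @shiftP i _ _ (transports_slide_cap b0).
  by rewrite /= addn0 addn1.
- move=> o b0; have /(_ isT) := @shiftP i _ _ (transports_R1_right o b0).
  by rewrite /= addn0 addn1.
- move=> o b0; have /(_ isT) := @shiftP i _ _ (transports_R1_left o b0).
  by rewrite /= addn0 addn1.
- move=> b0; have /(_ isT) := @shiftP i _ _ (transports_R2 b0).
  by rewrite /= addn0.
- move=> b0 c d h; have /(_ isT) := @shiftP i _ _ (transports_R3 h).
  by rewrite /= addn0 addn1.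
Qed.

(** * Components and colourings *)

(** Labels are indexed by slices because [level] names the origin of a strand by the slice of its
    minimum; only the labels of minima matter, see [eq_colorw]. *)
Definition colorw (T : Type) (l : nat -> T) (w : word) : cword T :=
  [seq paint (l t) (slice_at w t) | t <- iota 0 (size w)].

Lemma size_colorw (T : Type) (l : nat -> T) w : size (colorw l w) = size w.
Proof. by rewrite size_map size_iota. Qed.

Lemma plainw_colorw (T : Type) (l : nat -> T) w : plainw (colorw l w) = w.
Proof.
apply: (@eq_from_nth _ (0, Cap)%N); first by rewrite size_map size_colorw.
move=> t; rewrite size_map size_colorw => lt_t.
rewrite (nth_map (0%N, CCap)) ?size_colorw // (nth_map 0%N) ?size_iota //.
by rewrite plain_paint nth_iota.
Qed.

Lemma recolor_colorw (T U : Type) (g : T -> U) (l : nat -> T) w :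
  recolor g (colorw l w) = colorw (g \o l) w.
Proof.
rewrite /recolor -map_comp; apply: eq_map => t.
by rewrite /= /paint; case: slice_at => i [].
Qed.

Definition is_cup (x : slice) : bool := if x.2 is Cup _ then true else false.

Lemma eq_colorw (T : Type) (l l' : nat -> T) w :
  (forall t, (t < size w)%N -> is_cup (slice_at w t) -> l t = l' t) ->
  colorw l w = colorw l' w.
Proof.
move=> h; apply/eq_in_map => t; rewrite mem_iota /= add0n => /h.
by rewrite /paint /is_cup; case: slice_at => i [o|//|//] /= ->.
Qed.

Definition color_at (T : Type) (d : T) (w : cword T) (t : nat) : T :=
  if (nth (0%N, CCap) w t).2 is CCup _ c then c else d.

Lemma colorw_color_at (T : Type) (d : T) (w : cword T) :
  w = colorw (color_at d w) (plainw w).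
Proof.
apply: (@eq_from_nth _ (0%N, CCap)); first by rewrite size_colorw size_map.
move=> t lt_t.
rewrite (nth_map 0%N) ?size_iota ?size_map // nth_iota ?size_map // add0n.
rewrite /slice_at (nth_map (0%N, CCap)) // /color_at.
by case: nth => i [].
Qed.

Lemma used_colorw (T : eqType) (l : nat -> T) w : used (colorw l w) =
  [seq l t | t <- iota 0 (size w) & is_cup (slice_at w t)].
Proof.
rewrite /colorw /is_cup; elim: (iota _ _) => //= t s IH.
by rewrite /used /= -[pmap _ _]/(used _) IH; case: slice_at => i [].
Qed.

Section Level.
Variables (T : eqType) (l : nat -> T).

Definition cap_ok (x : slice) (st : seq strand) : bool :=
  if x.2 is Cap
  then l (nth (true, 0%N) st x.1).2 == l (nth (true, 0%N) st x.1.+1).2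
  else true.

(** The link between coloured runs and [level], [fits], [step]: replacing the origin of each strand
    by its label turns levels into states, and the only new condition is [cap_ok]. *)
Lemma cstep_paint t x st :
  cstep (paint (l t) x) (recolor_st l st) =
  if fits x st && cap_ok x st then Some (recolor_st l (step t x st)) else None.
Proof.
case: x => i e; rewrite /fits /cap_ok /step /paint /=.
have [le_i|lt_i] := leqP i (size st); last first.
  case E: cstep => [s1|].
    have [p [s [_ [Est /= Ei _ _]]]] := cstepP E.
    by move: lt_i; rewrite -(size_recolor_st l) Est Ei size_cat ltnNge leq_addr.
  have nlt : (i.+1 < size st)%N = false by lia.
  by case: e {E} => [o||b] //=; rewrite nlt.
have [p [s [-> {le_i st} ->]]] : exists p s, st = p ++ s /\ i = size p.
  by exists (take i st), (drop i st); rewrite cat_take_drop size_takel.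
rewrite recolor_st_cat -{1}(size_recolor_st l p) cstepE.
have nth0 : nth (true, 0%N) (p ++ s) (size p) = nth (true, 0%N) s 0.
  by rewrite nth_cat ltnn subnn.
have nth1 : nth (true, 0%N) (p ++ s) (size p).+1 = nth (true, 0%N) s 1.
  by rewrite nth_cat ltnNge leqnSn /= subSnn.
have drop2 : drop (size p).+2 (p ++ s) = drop 2 s.
  by rewrite drop_cat ltnNge ltnW //= -addn2 addKn.
have sz : ((size p).+1 < size (p ++ s))%N = (1 < size s)%N.
  by rewrite size_cat -addn1 ltn_add2l.
rewrite nth0 nth1 drop2 sz take_size_cat // drop_size_cat //.
case: e => [o||b] /=; first by rewrite recolor_st_cat.
- case: s {nth0 nth1 drop2 sz} => [|x [|y s]] //=.
  by rewrite drop0; case: ifP => //= _; rewrite recolor_st_cat.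
- case: s {nth0 nth1 drop2 sz} => [|x [|y s]] //=.
  by rewrite drop0 recolor_st_cat.
Qed.

Definition slices_ok w n : bool :=
  all (fun s => fits (slice_at w s) (level w s) &&
                cap_ok (slice_at w s) (level w s)) (iota 0 n).

Lemma crun_take w t : (t <= size w)%N ->
  crun (take t (colorw l w)) [::] =
  if slices_ok w t then Some (recolor_st l (level w t)) else None.
Proof.
elim: t => [|t IH] lt_t; first by rewrite take0.
rewrite (take_nth (0%N, CCap)) ?size_colorw // -cats1 crun_cat IH ?(ltnW lt_t) //.
rewrite /slices_ok -addn1 iotaD all_cat add0n /= andbT.
case: ifP => //= _; rewrite (nth_map 0%N) ?size_iota // nth_iota // cstep_paint.
by rewrite add0n addn1; case: ifP.
Qed.

End Level.

Definition valid (T : eqType) (w : cword T) : bool := crun w [::] == Some [::].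

Lemma valid_recolor (T U : eqType) (g : T -> U) (w : cword T) :
  valid w -> valid (recolor g w).
Proof. by move=> /eqP/(crun_recolor g) h; apply/eqP. Qed.

Lemma valid_colorw (T : eqType) (l : nat -> T) w :
  valid (colorw l w) = slices_ok l w (size w) && nilp (level w (size w)).
Proof.
rewrite /valid -(take_size (colorw l w)) size_colorw
  crun_take //; case: ifP => //= _.
by case: level.
Qed.

Lemma diagramE w : diagram w = (0 < size w)%N && valid (mono w).
Proof.
have -> : mono w = colorw (fun=> tt) w.
  by rewrite -{1}(plainw_colorw (fun=> tt) w) mono_plainw recolor_colorw.
rewrite valid_colorw /diagram; congr (_ && (_ && _)).
apply: eq_all => t /=; rewrite /cap_ok.
by case: (slice_at w t) => i [o||b] /=; rewrite ?eqxx andbT.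
Qed.

Lemma valid_diagram (T : eqType) (w : cword T) :
  (0 < size w)%N -> valid w -> diagram (plainw w).
Proof.
by move=> w0 vw; rewrite diagramE size_map w0 mono_plainw valid_recolor.
Qed.

Lemma valid_used (T : eqType) (w : cword T) :
  (0 < size w)%N -> valid w -> exists c, c \in used w.
Proof.
case: w => // -[i e] w _ /eqP/= h; case E: cstep h => [s1|] //= _.
have [p [s [s' [Es _ Ea _]]]] := cstepP E.
case: p s Es Ea => [|? ?] [|? ?] //= _.
by case: e {E} => //= o c _; exists c; rewrite mem_head.
Qed.

Lemma diagram_slices_ok (T : eqType) (l : nat -> T) w t :
  slices_ok l w (size w) -> (t <= size w)%N ->
  crun (take t (colorw l w)) [::] = Some (recolor_st l (level w t)).
Proof.
move=> ok le_t; rewrite crun_take // (_ : slices_ok _ _ _) //.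
apply/allP => s; rewrite mem_iota add0n => /= lt_s.
by move/allP: ok; apply; rewrite mem_iota add0n (leq_trans lt_s).
Qed.

Lemma level_is_cup w t x : diagram w -> (t <= size w)%N -> x \in level w t ->
  (x.2 < t)%N /\ is_cup (slice_at w x.2).
Proof.
move=> dw; elim: t x => //= t IH x lt_t.
have ft : fits (slice_at w t) (level w t).
  by case/and3P: dw => _ /allP h _; apply: h; rewrite mem_iota.
have old y : y \in level w t -> (y.2 < t.+1)%N /\ is_cup (slice_at w y.2).
  by case/(IH _ (ltnW lt_t)) => h1 h2; split; rewrite // ltnS ltnW.
case E: (slice_at w t) ft => [i [o||b]]; rewrite /fits /step /= => ft.
- rewrite mem_cat !inE => /orP[/mem_take|/or3P[/eqP->|/eqP->|/mem_drop]]; try exact: old.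
    by rewrite /= E.
  by rewrite /= E.
- by rewrite mem_cat => /orP[/mem_take|/mem_drop]; exact: old.
- rewrite mem_cat !inE => /orP[/mem_take|/or3P[/eqP->|/eqP->|/mem_drop]]; try exact: old.
    by apply: old; rewrite mem_nth.
  by apply: old; rewrite mem_nth // ltnW.
Qed.

(** A slice-by-slice form, to be compared with [sublink], which is not defined by recursion along
    the word. *)
Lemma csub_flatten (T : eqType) (P : pred T) (w : cword T) st st' :
  crun w st = Some st' ->
  csub P w st = flatten [seq csub1 P (nth (0%N, CCap) w t)
                             (odflt [::] (crun (take t w) st))
                        | t <- iota 0 (size w)].
Proof.
elim: w st => [|x w IH] st //=; case E: cstep => [s1|] //= /IH ->.
congr (_ ++ _); rewrite -addn1 addnC iotaDl -map_comp; congr flatten.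
by apply: eq_map => t /=; rewrite E.
Qed.

Lemma csum_sum (T : eqType) (r : rel T) (w : cword T) st st' :
  crun w st = Some st' ->
  csum r w st = \sum_(0 <= t < size w)
     csign r (nth (0%N, CCap) w t) (odflt [::] (crun (take t w) st)).
Proof.
elim: w st => [|x w IH] st; first by rewrite big_nil.
rewrite /=; case E: cstep => [s1|] //= /IH ->.
rewrite big_nat_recl //=; congr (_ + _).
by apply: eq_bigr => t _ /=; rewrite E.
Qed.

Section Components.
Variable w : word.

Definition component (t : nat) : {set 'I_(size w)} :=
  if insub t is Some s then [set y in minima w | connect (@joined w) s y]
  else set0.

Definition canon : cword {set 'I_(size w)} := colorw component w.

Lemma joined_sym : symmetric (@joined w).
Proof.
move=> s t; apply: eq_existsb => u; case: (slice_at w u).2 => //=.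
by rewrite orbC.
Qed.

Lemma component_ord (s : 'I_(size w)) :
  component s = [set y in minima w | connect (@joined w) s y].
Proof. by rewrite /component valK. Qed.

Lemma component_eq (s t : 'I_(size w)) : connect (@joined w) s t ->
  component s = component t.
Proof.
move=> st; rewrite !component_ord; apply/setP => y; rewrite !inE.
by rewrite (same_connect (sym_connect_sym joined_sym) st).
Qed.

Lemma componentsP (A : {set 'I_(size w)}) :
  reflect (exists2 s, s \in minima w & A = component s) (A \in components w).
Proof.
apply: (iffP imsetP) => -[s ms ->]; exists s; rewrite ?component_ord //.
Qed.

Lemma mem_minima (s : 'I_(size w)) : (s \in minima w) = is_cup (slice_at w s).
Proof. by rewrite inE. Qed.

Lemma mem_component (s : 'I_(size w)) : s \in minima w -> s \in component s.
Proof. by move=> ms; rewrite component_ord inE ms connect0. Qed.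

Lemma in_component (s t : 'I_(size w)) : t \in minima w ->
  (t \in component s) = (component t == component s).
Proof.
move=> mt; apply/idP/eqP => [|<-]; last exact: mem_component.
by rewrite {1}component_ord in_set => /andP[_ /component_eq ->].
Qed.

Hypothesis dw : diagram w.

Lemma strand_minimum t x : (t <= size w)%N -> x \in level w t ->
  exists2 s : 'I_(size w), s \in minima w & x.2 = s.
Proof.
move=> le_t /(level_is_cup dw le_t)[lt_x cx].
by exists (Ordinal (leq_trans lt_x le_t)); rewrite ?mem_minima.
Qed.

Lemma diagram_fits t : (t < size w)%N -> fits (slice_at w t) (level w t).
Proof.
by move=> lt_t; case/and3P: dw => _ /allP h _; apply: h; rewrite mem_iota.
Qed.

Lemma cap_joined (u : 'I_(size w)) : (slice_at w u).2 = Cap ->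
  exists s t : 'I_(size w),
    [/\ (strand_at w u (slice_at w u).1).2 = s,
        (strand_at w u (slice_at w u).1.+1).2 = t & joined s t].
Proof.
move=> cu; have := diagram_fits (ltn_ord u).
rewrite /fits cu => /andP[lt_i _].
have [s _ Es] := strand_minimum (ltnW (ltn_ord u)) (mem_nth (true, 0%N) (ltnW lt_i)).
have [t _ Et] := strand_minimum (ltnW (ltn_ord u)) (mem_nth (true, 0%N) lt_i).
exists s, t; split=> //; apply/existsP; exists u; rewrite cu /strand_at Es Et.
by rewrite !eqxx.
Qed.

(** In a diagram a coloured run can only fail at a maximum with two different labels, and [joined]
    records the pairs of minima that meet at maxima. *)
Lemma valid_colorwP (T : eqType) (l : nat -> T) :
  reflect (forall s t : 'I_(size w), joined s t -> l s = l t)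
          (valid (colorw l w)).
Proof.
have nl : nilp (level w (size w)) by case/and3P: dw.
rewrite valid_colorw nl andbT; apply: (iffP allP) => [h s t|h t].
  case/existsP => u; case cu: (slice_at w u).2 => //.
  have := h u; rewrite mem_iota add0n ltn_ord => /(_ isT)/andP[_].
  by rewrite /cap_ok cu /strand_at => /eqP el /orP[]/andP[/eqP<- /eqP<-].
rewrite mem_iota add0n => /= lt_t; rewrite diagram_fits //= /cap_ok.
case cu: (slice_at w t).2 => //; apply/eqP.
by have [s [s' [-> -> /h]]] := @cap_joined (Ordinal lt_t) cu.
Qed.

Lemma canon_valid : valid canon.
Proof. by apply/valid_colorwP => s t /connect1/component_eq. Qed.

Lemma used_canon : used canon =i components w.
Proof.
move=> A; rewrite used_colorw; apply/mapP/componentsP => [[t]|[s ms ->]].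
  rewrite mem_filter mem_iota add0n => /and3P[ct _ lt_t] ->.
  by exists (Ordinal lt_t); rewrite ?mem_minima.
exists (val s) => //; rewrite mem_filter mem_iota -mem_minima ms.
exact: (ltn_ord s).
Qed.

(** The universal property of [canon]: labels of a valid colouring agree along [joined], hence on
    each component, so one colour per component determines it. *)
Lemma valid_factor (T : finType) (cw : cword T) : plainw cw = w -> valid cw ->
  exists g : {set 'I_(size w)} -> T, cw = recolor g canon.
Proof.
move=> Ew vw.
have sw : (0 < size cw)%N by rewrite -(size_map (@plain T)) -/(plainw _) Ew; case/and3P: dw.
have [d _] := valid_used sw vw; pose l := color_at d cw.
have Ecw : cw = colorw l w by rewrite -Ew -colorw_color_at.
have ljoin : forall s t : 'I_(size w), joined s t -> l s = l t.
  by apply/valid_colorwP; rewrite -Ecw.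
have lconn : forall s t : 'I_(size w), connect (@joined w) s t -> l s = l t.
  move=> s t /connectP[p]; elim: p s => [|s' p IH] s /=; first by move=> _ ->.
  by case/andP => /ljoin -> /IH.
(* The colour of a component is read at any of its minima; [d] is returned only on the empty set. *)
exists (fun A : {set _} => if [pick s in A] is Some s then l (val s) else d).
rewrite recolor_colorw {1}Ecw; apply: eq_colorw => t lt_t ct /=.
have mt : Ordinal lt_t \in minima w by rewrite mem_minima.
case: pickP => [s|/(_ (Ordinal lt_t))]; last first.
  by rewrite -[component t]/(component (Ordinal lt_t)) mem_component.
rewrite -[component t]/(component (Ordinal lt_t)) component_ord inE.
by case/andP => _ /lconn.
Qed.

Definition used_set (T : finType) (cw : cword T) : {set T} := [set c in used cw].

Lemma used_set_recolor (T U : finType) (g : T -> U) (cw : cword T) :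
  used_set (recolor g cw) = g @: used_set cw.
Proof.
apply/setP => c; rewrite inE used_recolor; apply/mapP/imsetP => -[x h ->];
  exists x; by rewrite ?inE // in h *.
Qed.

Lemma used_set_canon : used_set canon = components w.
Proof. by apply/setP => A; rewrite inE used_canon. Qed.

(** With [used_set_canon], this identifies the number of components as the largest number of colours
    of a valid colouring; later comparisons of numbers of components rest on it. *)
Lemma leq_used_components (T : finType) (cw : cword T) :
  plainw cw = w -> valid cw -> (#|used_set cw| <= #|components w|)%N.
Proof.
move=> Ew /(valid_factor Ew)[g ->].
by rewrite used_set_recolor used_set_canon leq_imset_card.
Qed.

Lemma mem_cover_component (B : {set {set 'I_(size w)}}) (s : 'I_(size w)) :
  B \subset components w -> s \in minima w ->
  (s \in cover B) = (component s \in B).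
Proof.
move=> /subsetP sB ms; apply/bigcupP/idP => [[A AB sA]|cB]; last first.
  by exists (component s); rewrite ?mem_component.
have /componentsP[t mt EA] := sB _ AB.
by move: sA; rewrite EA in_component // => /eqP->; rewrite -EA.
Qed.

Lemma on_cover (B : {set {set 'I_(size w)}}) t x :
  B \subset components w -> (t <= size w)%N -> x \in level w t ->
  on (cover B) x = (component x.2 \in B).
Proof.
move=> sB le_t /(strand_minimum le_t)[s ms Es].
rewrite Es -mem_cover_component //; apply/existsP/idP => [[s']|sB'].
  by rewrite Es => /andP[s'B /eqP/val_inj <-].
by exists s; rewrite sB' Es /=.
Qed.

Lemma on_component A t x : A \in components w -> (t <= size w)%N ->
  x \in level w t -> on A x = (component x.2 == A).
Proof.
move=> cA le_t xt; have EA : cover [set A] = A by rewrite /cover big_set1.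
by rewrite -{1}EA (on_cover _ le_t) ?inE // sub1set.
Qed.

Lemma crun_canon t : (t <= size w)%N ->
  crun (take t canon) [::] = Some (recolor_st component (level w t)).
Proof.
move=> le_t; apply: diagram_slices_ok => //.
by have := canon_valid; rewrite valid_colorw => /andP[].
Qed.

Lemma nth_canon t : (t < size w)%N ->
  nth (0%N, CCap) canon t = paint (component t) (slice_at w t).
Proof. by move=> lt_t; rewrite (nth_map 0%N) ?size_iota // nth_iota. Qed.

Lemma drop_two (A : Type) (x0 : A) s i : (i.+1 < size s)%N ->
  drop i s = [:: nth x0 s i, nth x0 s i.+1 & drop i.+2 s].
Proof. by move=> lt_i; rewrite (drop_nth x0 (ltnW lt_i)) (drop_nth x0 lt_i). Qed.

Lemma sublink_canon (B : {set {set 'I_(size w)}}) : B \subset components w ->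
  sublink (cover B) = plainw (csub (mem B) canon [::]).
Proof.
move=> sB; rewrite (csub_flatten _ (eqP canon_valid)) size_colorw.
rewrite -val_enum_ord -map_comp /plainw map_flatten -map_comp.
have -> : sublink (cover B) =
    flatten [seq oapp (fun x => [:: x]) [::] (sublink_slice (cover B) t)
            | t <- enum 'I_(size w)].
  by rewrite /sublink; elim: (enum _) => //= t s ->; case: sublink_slice.
congr flatten; apply: eq_map => t /=.
have lt_t := ltn_ord t; rewrite crun_canon 1?ltnW // nth_canon //= csub1_def.
have onE x : x \in level w t -> on (cover B) x = (component x.2 \in B).
  by apply: on_cover; rewrite // ltnW.
rewrite /sublink_slice /recolor_st -map_take -map_drop count_map.
have -> : count (on (cover B)) (take (slice_at w t).1 (level w t)) =
          count (preim (fun x : strand => (x.1, component x.2))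
                   (fun y => (mem B) y.2)) (take (slice_at w t).1 (level w t)).
  by apply: eq_in_count => x /mem_take /onE ->.
have := diagram_fits lt_t; rewrite /fits /paint.
case E: (slice_at w t) => [i [o||b]] /= => [_|/andP[lt_i _]|lt_i].
- have ct : t \in minima w by rewrite mem_minima E.
  by rewrite mem_cover_component //; case: ifP.
- rewrite (drop_two (true, 0%N) lt_i) /= !onE ?mem_nth // 1?ltnW //.
  by case: ifP.
- rewrite (drop_two (true, 0%N) lt_i) /= !onE ?mem_nth // 1?ltnW //.
  by case: ifP.
Qed.

Definition left_component (t : nat) :=
  component (strand_at w t (slice_at w t).1).2.
Definition right_component (t : nat) :=
  component (strand_at w t (slice_at w t).1.+1).2.

Lemma csum_canon r : csum r canon [::] =
  \sum_(t < size w | r (left_component t) (right_component t))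
     crossing_sign w t.
Proof.
rewrite (csum_sum _ (eqP canon_valid)) size_colorw big_mkord [RHS]big_mkcond.
apply: eq_bigr => t _; have lt_t := ltn_ord t.
rewrite crun_canon 1?ltnW // nth_canon //= csign_def /crossing_sign /recolor_st.
rewrite -map_drop /left_component /right_component /strand_at.
have := diagram_fits lt_t; rewrite /fits /paint.
case E: (slice_at w t) => [i [o||b]] /=; try by case: ifP.
by move=> lt_i; rewrite (drop_two (true, 0%N) lt_i).
Qed.

Lemma crossing_components t : (t < size w)%N -> crossing_sign w t != 0 ->
  left_component t \in components w /\ right_component t \in components w.
Proof.
move=> lt_t; have := diagram_fits lt_t.
rewrite /fits /crossing_sign /left_component /right_component.
case E: (slice_at w t) => [i [o||b]] //= lt_i _.
have memi : strand_at w t i \in level w t by rewrite mem_nth // ltnW.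
have memi1 : strand_at w t i.+1 \in level w t by rewrite mem_nth.
have [s ms ->] := strand_minimum (ltnW lt_t) memi.
have [s' ms' ->] := strand_minimum (ltnW lt_t) memi1.
by split; apply/componentsP; [exists s|exists s'].
Qed.

Lemma sum_crossing_between A B : A \in components w -> B \in components w ->
  \sum_(t < size w | crossing_between A B t) crossing_sign w t =
  csum (between A B) canon [::].
Proof.
move=> cA cB; rewrite csum_canon big_mkcond [RHS]big_mkcond.
apply: eq_bigr => t _; have lt_t := ltn_ord t.
have := diagram_fits lt_t.
rewrite /fits /crossing_sign /left_component /right_component /crossing_between.
case E: (slice_at w t) => [i [o||b]] //=; do ?by case: ifP.
move=> lt_i.
have memi : strand_at w t i \in level w t by rewrite mem_nth // ltnW.
have memi1 : strand_at w t i.+1 \in level w t by rewrite mem_nth.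
by rewrite !(on_component _ (ltnW lt_t)).
Qed.

Lemma double_linking_number A B : A \in components w -> B \in components w ->
  A != B -> 2 * linking_number A B = csum (between A B) canon [::].
Proof.
move=> cA cB nAB; rewrite /linking_number sum_crossing_between //.
have := csum_between_even nAB (eqP canon_valid); rewrite /= !addr0 => h.
by rewrite mulrC divzK.
Qed.

(** If [X] and [Y] differ, exactly one of their two orderings is increasing for [enum_rank], and no
    other pair contributes; if they are equal, both sides vanish. *)
Lemma sum_unordered_pairs (T : finType) (C : {set T}) (d : rel T) X Y (s : int) :
  symmetric d -> irreflexive d -> X \in C -> Y \in C ->
  \sum_(A in C) \sum_(B in C | (enum_rank A < enum_rank B)%N && d A B)
     (if between A B X Y then s else 0) = if d X Y then s else 0.
Proof.
move=> ds di; wlog le_XY : X Y / (enum_rank X <= enum_rank Y)%N.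
  move=> th cX cY; have /orP[/th|/th] := leq_total (enum_rank X) (enum_rank Y); first exact.
  rewrite ds => <- //; apply: eq_bigr => A _; apply: eq_bigr => B _.
  by rewrite /between orbC [(X == B) && _]andbC [(X == A) && _]andbC.
move=> cX cY; have [->|nXY] := eqVneq X Y.
  rewrite di big1 // => A _; rewrite big1 // => B /and3P[_ lt_AB _].
  case: ifP => //; rewrite /between andbC orbb => /andP[/eqP EB /eqP EA].
  by move: lt_AB; rewrite -EA -EB ltnn.
have lt_XY : (enum_rank X < enum_rank Y)%N.
  by rewrite ltn_neqAle le_XY andbT; apply: contra nXY => /eqP/ord_inj/enum_rank_inj->.
rewrite (bigD1 X) //= [X in _ + X]big1 ?addr0; last first.
  move=> A /andP[_ nAX]; rewrite big1 // => B /and3P[_ lt_AB _].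
  case: ifP => //; rewrite /between eq_sym (negPf nAX) /= => /andP[/eqP XB /eqP YA].
  by move: lt_AB; rewrite -XB -YA ltnNge le_XY.
rewrite big_mkcond (bigD1 Y) //= [X in _ + X]big1 ?addr0; last first.
  move=> B nBY; case: ifP => //; case: ifP => //.
  rewrite /between eqxx [Y == B]eq_sym (negPf nBY) /=.
  by rewrite [Y == X]eq_sym (negPf nXY) andbF.
by rewrite cY lt_XY /= /between !eqxx.
Qed.

Lemma nu_canon (P : {set {set {set 'I_(size w)}}}) :
  2 * nu P = csum (fun A B => pblock P A != pblock P B) canon [::].
Proof.
rewrite csum_canon /nu mulr_sumr.
under eq_bigr => A cA.
  rewrite mulr_sumr.
  under eq_bigr => B /and3P[cB lt_AB _].
    rewrite double_linking_number //; last first.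
      by apply: contraTneq lt_AB => ->; rewrite ltnn.
    rewrite csum_canon big_mkcond; over.
  rewrite exchange_big; over.
rewrite exchange_big [RHS]big_mkcond /=; apply: eq_bigr => t _.
(* Slices that are not crossings are set aside first: the labels read at their positions need not be
   components. *)
have [s0|ns0] := eqVneq (crossing_sign w t) 0.
  by rewrite s0 if_same big1 // => A _; rewrite big1 // => B _; rewrite if_same.
have [cX cY] := crossing_components (ltn_ord t) ns0.
rewrite (@sum_unordered_pairs _ _ (fun A B => pblock P A != pblock P B)) //.
- by move=> A B; rewrite eq_sym.
- by move=> A; rewrite eqxx.
Qed.

End Components.

(** * Sums over partitions *)

Section PartitionPull.
Variables (T U : finType) (g : T -> U) (D : {set T}).
Implicit Types (P : {set {set T}}) (Q : {set {set U}}).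

(** The intersection discards the elements outside [D] that [g] happens to send into [B]. *)
Definition pull (B : {set U}) : {set T} := D :&: g @^-1: B.
Definition pull_partition Q : {set {set T}} := pull @: Q.
Definition push_partition P : {set {set U}} := (fun B : {set T} => g @: B) @: P.

(* The partitions of D of the form [pull_partition Q]. *)
Definition compatible P : bool :=
  [forall x in D, forall y in D, (g x == g y) ==> (pblock P x == pblock P y)].

Lemma compatibleP P : reflect
  {in D &, forall x y, g x = g y -> pblock P x = pblock P y} (compatible P).
Proof.
apply: (iffP forall_inP) => [h x y xD yD gxy|h x xD].
  by have /forall_inP/(_ y yD)/implyP := h x xD; rewrite gxy eqxx => /(_ isT)/eqP.
by apply/forall_inP => y yD; apply/implyP => /eqP/(h _ _ xD yD) ->.
Qed.

Lemma mem_pull (B : {set U}) (x : T) : (x \in pull B) = (x \in D) && (g x \in B).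
Proof. by rewrite !inE. Qed.

Lemma image_pull (B : {set U}) : B \subset g @: D -> g @: pull B = B.
Proof.
move=> /subsetP sB; apply/setP => y; apply/imsetP/idP => [[x]|yB].
  by rewrite mem_pull => /andP[_ ?] ->.
by have /imsetP[x xD Ey] := sB y yB; exists x; rewrite // mem_pull xD -Ey.
Qed.

Lemma block_subset (V : finType) (P : {set {set V}}) (C B : {set V}) :
  partition P C -> B \in P -> B \subset C.
Proof. by case/and3P => /eqP <- _ _; exact: bigcup_sup. Qed.

Lemma pull_inj Q : partition Q (g @: D) -> {in Q &, injective pull}.
Proof.
move=> pQ A B AQ BQ eqAB.
by rewrite -(image_pull (block_subset pQ AQ)) eqAB image_pull // (block_subset pQ).
Qed.

Lemma pull_partitionP Q :
  partition Q (g @: D) -> partition (pull_partition Q) D.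
Proof.
move=> pQ; have /and3P[/eqP cQ tQ nQ] := pQ; apply/and3P; split.
- apply/eqP/setP => x; apply/bigcupP/idP => [[_ /imsetP[B _ ->]]|xD].
    by rewrite mem_pull => /andP[].
  have : g x \in cover Q by rewrite cQ imset_f.
  by case/bigcupP => B BQ gB; exists (pull B); rewrite ?imset_f // mem_pull xD.
- apply/trivIsetP => _ _ /imsetP[A AQ ->] /imsetP[B BQ ->] nAB.
  have nAB' : A != B by apply: contra nAB => /eqP->.
  have /pred0P dAB := trivIsetP tQ _ _ AQ BQ nAB'.
  apply/pred0P => x /=; rewrite !mem_pull; apply/negP => /andP[/andP[_ xA] /andP[_ xB]].
  by have := dAB (g x); rewrite /= xA xB.
- apply/imsetP => -[B BQ /esym E]; move: nQ.
  by rewrite -(imset0 g) -E image_pull ?BQ // (block_subset pQ).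
Qed.

Lemma pblock_pull Q x : partition Q (g @: D) -> x \in D ->
  pblock (pull_partition Q) x = pull (pblock Q (g x)).
Proof.
move=> pQ xD; have /and3P[/eqP cQ tQ nQ] := pQ.
have gQ : g x \in cover Q by rewrite cQ imset_f.
apply: def_pblock; first by have /and3P[] := pull_partitionP pQ.
  by rewrite imset_f // pblock_mem.
by rewrite mem_pull xD mem_pblock.
Qed.

Lemma pblock_pull_eq Q x y : partition Q (g @: D) -> x \in D -> y \in D ->
  (pblock (pull_partition Q) x == pblock (pull_partition Q) y) =
  (pblock Q (g x) == pblock Q (g y)).
Proof.
move=> pQ xD yD; rewrite !pblock_pull //.
have /and3P[/eqP cQ _ _] := pQ.
apply/eqP/eqP => [|-> //]; apply: (pull_inj pQ); by rewrite pblock_mem // cQ imset_f.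
Qed.

Lemma compatible_pull Q : partition Q (g @: D) -> compatible (pull_partition Q).
Proof.
move=> pQ; apply/compatibleP => x y xD yD gxy.
by rewrite !pblock_pull // gxy.
Qed.

Lemma push_pull Q : partition Q (g @: D) -> push_partition (pull_partition Q) = Q.
Proof.
move=> pQ; rewrite /push_partition -imset_comp.
rewrite -[RHS]imset_id; apply: eq_in_imset => B BQ /=.
by rewrite image_pull // (block_subset pQ).
Qed.

Section Push.
Variable P : {set {set T}}.
Hypotheses (pP : partition P D) (cP : compatible P).

Lemma pull_image B : B \in P -> pull (g @: B) = B.
Proof.
move=> BP; have /and3P[/eqP cvP tP _] := pP.
have sB := subsetP (block_subset pP BP).
apply/setP => x; rewrite mem_pull; apply/andP/idP => [[xD /imsetP[y yB gxy]]|xB].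
  have := compatibleP _ cP x y xD (sB y yB) gxy.
  by rewrite (def_pblock tP BP yB) => <-; rewrite mem_pblock cvP.
by rewrite imset_f // sB.
Qed.

Lemma pull_push : pull_partition (push_partition P) = P.
Proof.
rewrite /pull_partition -imset_comp -[RHS]imset_id.
by apply: eq_in_imset => B BP /=; rewrite pull_image.
Qed.

Lemma push_partitionP : partition (push_partition P) (g @: D).
Proof.
have /and3P[/eqP cvP tP nP] := pP; apply/and3P; split.
- apply/eqP/setP => y; apply/bigcupP/imsetP => [[_ /imsetP[B BP ->]]|[x xD ->]].
    case/imsetP => x xB ->; exists x => //.
    exact: (subsetP (block_subset pP BP)).
  have xP : x \in cover P by rewrite cvP.
  exists (g @: pblock P x); first by rewrite imset_f // pblock_mem.
  by rewrite imset_f // mem_pblock.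
- apply/trivIsetP => _ _ /imsetP[A AP ->] /imsetP[B BP ->] nAB.
  have nAB' : A != B by apply: contra nAB => /eqP->.
  have /pred0P dAB := trivIsetP tP _ _ AP BP nAB'.
  apply/pred0P => y /=; apply/negP => /andP[/imsetP[x xA ->] gB].
  have xD := subsetP (block_subset pP AP) _ xA.
  have xB : x \in B by rewrite -(pull_image BP) mem_pull xD.
  by have := dAB x; rewrite /= xA xB.
- apply/imsetP => -[B BP /esym/eqP]; rewrite imset_eq0 => /eqP B0.
  by move: nP; rewrite -B0 BP.
Qed.

End Push.

(** [pull_partition] and [push_partition] are mutually inverse on these partitions. When [g] merges
    two colours, the partitions that keep the two together are thus matched with those for the
    smoothing. *)
Lemma big_compatible (R : Type) (idx : R) (op : Monoid.com_law idx)
    (F : {set {set T}} -> R) :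
  \big[op/idx]_(P | partition P D && compatible P) F P =
  \big[op/idx]_(Q | partition Q (g @: D)) F (pull_partition Q).
Proof.
rewrite (reindex_onto pull_partition push_partition) /=; last first.
  by move=> P /andP[pP cP]; rewrite pull_push.
apply: eq_bigl => Q; apply/idP/idP => [/andP[/andP[pP cP] /eqP<-]|pQ].
  exact: push_partitionP.
by rewrite pull_partitionP // compatible_pull // push_pull // eqxx.
Qed.

Lemma card_pull_partition Q :
  partition Q (g @: D) -> #|pull_partition Q| = #|Q|.
Proof. by move=> pQ; rewrite card_in_imset //; apply: pull_inj. Qed.

Lemma big_pull_partition (R : Type) (idx : R) (op : Monoid.com_law idx)
    (F : {set T} -> R) Q : partition Q (g @: D) ->
  \big[op/idx]_(B in pull_partition Q) F B = \big[op/idx]_(B in Q) F (pull B).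
Proof. by move=> pQ; rewrite big_imset //; apply: pull_inj. Qed.

Lemma compatible_inj P : {in D &, injective g} -> compatible P.
Proof. by move=> gi; apply/compatibleP => x y xD yD /gi ->. Qed.

End PartitionPull.

(* Sort the functions from D to 'I_N by the partition into their fibres. *)
Lemma card_ffun_partition (T : finType) (N : nat) :
  (N ^ #|T| = \sum_(P : {set {set T}} | partition P setT) N ^_ #|P|)%N.
Proof.
have -> : (N ^ #|T|)%N = #|{ffun T -> 'I_N}| by rewrite card_ffun card_ord.
rewrite -sum1_card (partition_big
  (fun f : {ffun T -> 'I_N} => preim_partition f setT) (fun P => partition P setT)) /=;
  last by move=> f _; apply: preim_partitionP.
apply: eq_bigr => P pP; have /and3P[/eqP cP tP nP] := pP.
have mP x : pblock P x \in P by rewrite pblock_mem // cP inE.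
(* A function constant on the blocks of [P] is a function of the block. Its fibres are the blocks
   themselves exactly when that function is injective, and [N ^_ #|P|] counts the injective ones. *)
pose h (f : {ffun {B : {set T} | B \in P} -> 'I_N}) : {ffun T -> 'I_N} :=
  [ffun x => f (exist _ (pblock P x) (mP x))].
have blockP (B : {B : {set T} | B \in P}) : exists x, x \in val B.
  by apply/set0Pn; apply: contraNneq nP => <-; apply: valP.
have hE f (B : {B : {set T} | B \in P}) x : x \in val B -> h f x = f B.
  move=> xB; rewrite ffunE; congr (f _); apply: val_inj => /=.
  exact: def_pblock (valP B) xB.
have h_inj : injective h.
  move=> f f' eqf; apply/ffunP => B; have [x xB] := blockP B.
  by rewrite -(hE f B x xB) eqf (hE f' B x xB).
have eqv (f : {ffun T -> 'I_N}) :
    {in setT & &, equivalence_rel (fun x y => f x == f y)}.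
  by move=> x y z _ _ _; split=> // /eqP->.
have -> : (N ^_ #|P|)%N =
    #|[set f : {ffun {B : {set T} | B \in P} -> 'I_N} | injectiveb f]|.
  by rewrite card_inj_ffuns card_ord card_sig.
rewrite -(card_imset _ h_inj) -sum1_card; apply: eq_bigl => f.
apply/eqP/imsetP => [pf|[f' ]].
  have fE x y : (y \in pblock P x) = (f x == f y).
    by rewrite -pf (pblock_equivalence_partition (eqv f)).
  pose f' : {ffun {B : {set T} | B \in P} -> 'I_N} :=
    [ffun B => f (xchoose (blockP B))].
  exists f'; last first.
    apply/ffunP => x; rewrite /h !ffunE; apply/eqP; rewrite -fE.
    exact: (xchooseP (blockP (exist _ (pblock P x) (mP x)))).
  rewrite inE; apply/injectiveP => B C; rewrite !ffunE => /eqP; rewrite -fE.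
  have xB := xchooseP (blockP B); have xC := xchooseP (blockP C).
  rewrite (def_pblock tP (valP B) xB) => xCB.
  apply: val_inj; rewrite /= -(def_pblock tP (valP B) xCB).
  exact: def_pblock (valP C) xC.
rewrite inE => /injectiveP f'_inj ->.
rewrite -[RHS](equivalence_partition_pblock pP) /preim_partition.
apply: eq_in_imset => x _; apply/setP => y; rewrite !inE /= !ffunE.
rewrite (inj_eq f'_inj) -val_eqE /= eq_sym; apply/eqP/idP => [<-|yx].
  by rewrite mem_pblock cP inE.
by rewrite (same_pblock tP yx).
Qed.

(* Both sides are polynomials in x, and they agree at every natural number. *)
Lemma sum_partition_falling (R : idomainType) (T : finType) (x : R) :
  (forall n, (n%:R == 0 :> R) = (n == 0)%N) ->
  \sum_(P : {set {set T}} | partition P setT) \prod_(0 <= j < #|P|) (x - j%:R)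
  = x ^+ #|T|.
Proof.
move=> char0.
pose p : {poly R} := \sum_(P : {set {set T}} | partition P setT)
  \prod_(0 <= j < #|P|) ('X - j%:R%:P) - 'X ^+ #|T|.
have pE y : p.[y] = \sum_(P : {set {set T}} | partition P setT)
     \prod_(0 <= j < #|P|) (y - j%:R) - y ^+ #|T|.
  rewrite /p hornerD hornerN hornerXn horner_sum; congr (_ - _).
  apply: eq_bigr => P _; rewrite horner_prod; apply: eq_bigr => j _.
  by rewrite hornerXsubC.
have fallE N k : \prod_(0 <= j < k) (N%:R - j%:R) = (N ^_ k)%:R :> R.
  elim: k => [|k IH]; first by rewrite big_nil ffactn0.
  rewrite big_nat_recr //= IH ffactnSr natrM.
  have [le_kN|lt_Nk] := leqP k N; first by rewrite natrB.
  by rewrite ffact_small // !mul0r.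
have root_p N : root p N%:R.
  rewrite /root pE subr_eq0 -natrX card_ffun_partition natr_sum.
  by apply/eqP; apply: eq_bigr => P _; rewrite fallE.
have p0 : p = 0.
  apply/eqP/negPn/negP => np0.
  have := max_poly_roots np0 (rs := [seq n%:R | n <- iota 0 (size p)]).
  rewrite size_map size_iota ltnn => h; suff : false by [].
  apply: h; first by apply/allP => _ /mapP[n _ ->].
  rewrite map_inj_in_uniq ?iota_uniq // => m n _ _.
  have inj_le a b : (a <= b)%N -> a%:R = b%:R :> R -> a = b.
    move=> le_ab /eqP; rewrite eq_sym -subr_eq0 -natrB // char0 => ?.
    by apply/eqP; rewrite eqn_leq le_ab.
  by case/orP: (leq_total m n) => /inj_le h // /esym/h.
by apply/eqP; rewrite -subr_eq0 -pE p0 horner0.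
Qed.

(** * Conway triples and concatenation *)

Section Localization.
Variables (A : comNzRingType) (F : fieldType) (f : {rmorphism A -> F}) (d : A).
Hypothesis d_neq0 : f d != 0.

(** Serves both rings of Laurent polynomials: [d] is ['X] for those in q, and the product of the two
    indeterminates for those in q and E, so that a single exponent suffices. *)
Definition localized (x : F) : Prop := exists a k, x = f a / f d ^+ k.

Lemma localized_image a : localized (f a).
Proof. by exists a, 0; rewrite expr0 divr1. Qed.

Lemma localizedD x y : localized x -> localized y -> localized (x + y).
Proof.
move=> [a [k ->]] [b [m ->]]; exists (a * d ^+ m + b * d ^+ k), (k + m)%N.
rewrite rmorphD !rmorphM !rmorphXn exprD; field.
by rewrite !expf_neq0.
Qed.

Lemma localizedM x y : localized x -> localized y -> localized (x * y).
Proof.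
move=> [a [k ->]] [b [m ->]]; exists (a * b), (k + m)%N.
by rewrite rmorphM exprD mulf_div.
Qed.

Lemma localizedN x : localized x -> localized (- x).
Proof. by move=> [a [k ->]]; exists (- a), k; rewrite rmorphN mulNr. Qed.

Lemma localizedV : localized (f d)^-1.
Proof. by exists 1, 1; rewrite rmorph1 expr1 div1r. Qed.

Lemma localizedX x n : localized x -> localized (x ^+ n).
Proof.
move=> hx; elim: n => [|n IH]; last by rewrite exprS; apply: localizedM.
by rewrite expr0 -(rmorph1 f); apply: localized_image.
Qed.

Lemma localized_sum (I : Type) (r : seq I) (P : pred I) (g : I -> F) :
  (forall i, P i -> localized (g i)) -> localized (\sum_(i <- r | P i) g i).
Proof.
move=> h; apply: big_ind => //; last exact: localizedD.
by rewrite -(rmorph0 f); apply: localized_image.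
Qed.

Lemma localized_prod (I : Type) (r : seq I) (P : pred I) (g : I -> F) :
  (forall i, P i -> localized (g i)) -> localized (\prod_(i <- r | P i) g i).
Proof.
move=> h; apply: big_ind => //; last exact: localizedM.
by rewrite -(rmorph1 f); apply: localized_image.
Qed.

End Localization.

Lemma diagram_cat u v : diagram u -> diagram v -> diagram (u ++ v).
Proof.
rewrite !diagramE => /andP[u0 /eqP hu] /andP[v0 /eqP hv].
by rewrite size_cat addn_gt0 u0 /= /valid mono_cat crun_cat hu /= hv.
Qed.

Lemma isotopic_cat_left k w w' : diagram k ->
  isotopic w w' -> isotopic (k ++ w) (k ++ w').
Proof.
move=> dk; elim=> {w w'} [w w'|w|w w' _|w w' w'' _ h1 _ h2].
- move=> [dw dw' [u [a [b [v [Ew Ew' m]]]]]]; apply: rst_step.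
  split; try exact: diagram_cat.
  by exists (k ++ u), a, b, v; rewrite Ew Ew' !catA.
- exact: rst_refl.
- exact: rst_sym.
- exact: rst_trans h1 h2.
Qed.

Lemma isotopic_cat_right k w w' : diagram k ->
  isotopic w w' -> isotopic (w ++ k) (w' ++ k).
Proof.
move=> dk; elim=> {w w'} [w w'|w|w w' _|w w' w'' _ h1 _ h2].
- move=> [dw dw' [u [a [b [v [Ew Ew' m]]]]]]; apply: rst_step.
  split; try exact: diagram_cat.
  by exists u, a, b, (v ++ k); rewrite Ew Ew' -!catA.
- exact: rst_refl.
- exact: rst_sym.
- exact: rst_trans h1 h2.
Qed.

(** [smoothing] as a function of directions alone, so that it applies to strands with any type of
    colours. *)
Definition smooth (i : nat) (dx dy : bool) : word :=
  if dx == dy then [::] else [:: (i, Cap); (i, Cup dy)].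

Lemma level_state (T : eqType) (d : T) (cw : cword T) t st :
  (t <= size cw)%N -> crun (take t cw) [::] = Some st ->
  st = recolor_st (color_at d cw) (level (plainw cw) t).
Proof.
move=> le_t; rewrite {1}(colorw_color_at d cw) crun_take ?size_map //.
by case: ifP => // _ [<-].
Qed.

Lemma strand_at_state (T : eqType) (d : T) (cu cv : cword T) st p :
  crun cu [::] = Some st -> (p < size st)%N ->
  nth (true, d) st p =
  let x := strand_at (plainw (cu ++ cv)) (size cu) p in
  (x.1, color_at d (cu ++ cv) x.2).
Proof.
move=> ru; have := @level_state T d (cu ++ cv) (size cu) st.
rewrite size_cat leq_addr take_size_cat // ru => /(_ isT erefl) Est lt_p.
have lt_p' : (p < size (level (plainw (cu ++ cv)) (size cu)))%N.
  by move: lt_p; rewrite Est size_recolor_st.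
by rewrite {1}Est /recolor_st (nth_map (true, 0%N)).
Qed.

Section ConwayTriples.
Variable T : eqType.
Implicit Types (cu cv : cword T) (p s : cstate T) (x y : bool * T).

Lemma conway_tripleI cu cv p x y s b :
  crun cu [::] = Some (p ++ [:: x, y & s]) ->
  crun cv (p ++ [:: y, x & s]) = Some [::] ->
  b == (x.1 == y.1) ->
  conway_triple (size cu) (size p)
    (plainw (cu ++ (size p, CCross b) :: cv))
    (plainw (cu ++ (size p, CCross (~~ b)) :: cv))
    (plainw cu ++ smooth (size p) x.1 y.1 ++ plainw cv).
Proof.
move=> ru rv pos; set Lp := plainw _.
have strand k : (k < size (p ++ [:: x, y & s]))%N ->
    (strand_at Lp (size cu) k).1 = (nth (true, x.2) (p ++ [:: x, y & s]) k).1.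
  by move=> lt_k; rewrite (strand_at_state _ ((size p, CCross b) :: cv) ru).
have Ex : (strand_at Lp (size cu) (size p)).1 = x.1.
  rewrite strand; first by rewrite nth_cat ltnn subnn.
  by rewrite size_cat addnS ltnS leq_addr.
have Ey : (strand_at Lp (size cu) (size p).+1).1 = y.1.
  rewrite strand; first by rewrite nth_cat ltnNge leqnSn /= subSnn.
  by rewrite size_cat !addnS !ltnS leq_addr.
exists (plainw cu), (plainw cv), b; split.
  split; [by rewrite size_map|by rewrite /Lp plainw_cat|by rewrite plainw_cat|].
  by rewrite /smoothing Ex Ey.
rewrite /positive Ex Ey; split=> //; apply: valid_diagram.
  by rewrite size_cat addnS.
by rewrite /valid crun_cat ru /= cstepE /= rv.
Qed.

(** The coloured word is cut at the crossing: [x] and [y] enter it, [p] and [s] pass beside it, and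
    the underlying words of [cu] and [cv] are common to the three diagrams. *)
Lemma conway_tripleE (cw : cword T) t i Lp Lm L0 :
  conway_triple t i Lp Lm L0 -> plainw cw = Lp -> valid cw ->
  exists cu cv p x y s b,
    [/\ crun cu [::] = Some (p ++ [:: x, y & s]),
        crun cv (p ++ [:: y, x & s]) = Some [::], b == (x.1 == y.1),
        (size cu = t /\ size p = i) /\ cw = cu ++ (i, CCross b) :: cv &
        Lm = plainw (cu ++ (size p, CCross (~~ b)) :: cv) /\
        L0 = plainw cu ++ smooth i x.1 y.1 ++ plainw cv].
Proof.
move=> [u [v [b [[su ELp ELm EL0] [dLp pos]]]]] Ecw vw.
have := Ecw; rewrite {1}ELp => /plainw_eq_cat[cu [cv0 [Ew Eu]]].
case: cv0 Ew => // -[j e] cv Ew [Ej Ee Ev]; subst j.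
have Ee' : e = CCross b by case: e Ee {Ew} => // c [->].
move: Ew; rewrite {e Ee}Ee' => Ew.
have := eqP vw; rewrite Ew => /crun_cat_some[st ru].
move=> /crun_cons_some[st' /cstepP[p [s [s' [Est /= Ei Es Est']]]] rv].
case: s Est Es => [|x [|y s]] // Est [Es']; subst s'.
have scu : size cu = t by rewrite -su -Eu size_map.
have Ex : (strand_at Lp t i).1 = x.1.
  rewrite -Ecw Ew -scu Ei -[x.1]/((x.1, x.2).1).
  have := @strand_at_state T x.2 cu ((i, CCross b) :: cv) st (size p) ru.
  rewrite Est size_cat addnS ltnS leq_addr nth_cat ltnn subnn -Ei.
  by move=> /(_ isT) /= ->.
have Ey : (strand_at Lp t i.+1).1 = y.1.
  rewrite -Ecw Ew -scu Ei.
  have := @strand_at_state T x.2 cu ((i, CCross b) :: cv) st (size p).+1 ru.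
  rewrite Est size_cat !addnS !ltnS leq_addr nth_cat ltnNge leqnSn /= subSnn -Ei.
  by move=> /(_ isT) /= ->.
exists cu, cv, p, x, y, s, b; split=> //.
- by rewrite ru Est.
- by rewrite -Est'.
- by move: pos; rewrite /positive Ex Ey.
- by split; [rewrite plainw_cat Eu /= Ev ELm -Ei|rewrite EL0 /smoothing Ex Ey Eu Ev].
Qed.

End ConwayTriples.

Lemma mono_conway k k' t i Lp Lm L0 : crun (mono k) [::] = Some [::] ->
  crun (mono k') [::] = Some [::] -> conway_triple t i Lp Lm L0 ->
  conway_triple (size k + t) i (k ++ Lp ++ k') (k ++ Lm ++ k') (k ++ L0 ++ k').
Proof.
move=> rk rk' ct.
have dLp : diagram Lp by case: ct => u [v [b [_ []]]].
have := dLp; rewrite diagramE => /andP[_ vLp].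
have [cu [cv [p [x [y [s [b [ru rv pos [[st sp] Ew] [-> ->]]]]]]]]] :=
  conway_tripleE ct (plain_mono Lp) vLp.
rewrite -(plain_mono Lp) Ew.
have := @conway_tripleI unit (mono k ++ cu) (cv ++ mono k') p x y s b.
rewrite !crun_cat rk /= ru rv /= => /(_ erefl rk' pos).
by rewrite size_cat size_map st sp !plainw_cat /= !plainw_cat !plain_mono -!catA.
Qed.

(** * The Jones polynomial of split unions *)

Lemma isotopic_step u v a b : diagram (u ++ a ++ v) -> diagram (u ++ b ++ v) ->
  local_move a b -> isotopic (u ++ a ++ v) (u ++ b ++ v).
Proof. by move=> da db m; apply: rst_step; split=> //; exists u, a, b, v. Qed.

Lemma isotopic_step_sym u v a b :
  diagram (u ++ a ++ v) -> diagram (u ++ b ++ v) ->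
  local_move a b -> isotopic (u ++ b ++ v) (u ++ a ++ v).
Proof. by move=> da db m; apply: rst_sym; apply: isotopic_step. Qed.

Definition kinked_unknot (b : bool) : word :=
  [:: (0, Cup true); (0, Cross b); (0, Cap)]%N.

Definition reversed_unknot : word := [:: (0, Cup false); (0, Cap)]%N.

(** The first Reidemeister move needs a strand running through the kink, whereas here the crossing
    joins the two branches of the only minimum. Inserting a zigzag creates that strand. Here it is
    inserted above the crossing, in [kinked_unknotE] below it; the two results show that both
    orientations of the circle are isotopic. *)
Lemma kinked_reversed b : isotopic (kinked_unknot b) reversed_unknot.
Proof.
apply: rst_trans (isotopic_step_sym (u := [:: (0, Cup true); (0, Cross b)]%N)
  (v := [:: (0, Cap)]%N) _ _ (move_zigzag_left 0 false)) _ => /=;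
  try by case: b.
apply: rst_trans (isotopic_step_sym (u := [:: (0, Cup true)]%N)
  (v := [:: (1, Cap); (0, Cap)]%N) _ _
  (move_commute 0 0 (Cup false) (Cross b))) _ => /=; try by case: b.
apply: rst_trans (isotopic_step_sym (u := [::])
  (v := [:: (2, Cross b); (1, Cap); (0, Cap)]%N) _ _
  (move_commute 0 0 (Cup false) (Cup true))) _ => /=; try by case: b.
have := move_slide_cap 1 (~~ b); rewrite negbK => m.
apply: rst_trans (isotopic_step_sym (u := [:: (0, Cup false); (2, Cup true)]%N)
  (v := [:: (0, Cap)]%N) _ _ m) _ => /=; try by case: b {m}.
by apply: (isotopic_step (u := [:: (0, Cup false)]%N)
  (v := [:: (0, Cap)]%N) _ _ (move_R1_right 1 true (~~ b))); case: b {m}.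
Qed.

Lemma kinked_unknotE b : isotopic (kinked_unknot b) unknot.
Proof.
apply: rst_trans (isotopic_step_sym (u := [:: (0, Cup true)]%N)
  (v := [:: (0, Cross b); (0, Cap)]%N) _ _ (move_zigzag_right 0 false)) _ => /=;
  try by case: b.
apply: rst_trans (isotopic_step (u := [:: (0, Cup true); (1, Cup false)]%N)
  (v := [:: (0, Cap)]%N) _ _
  (move_commute 0 0 Cap (Cross b))) _ => /=; try by case: b.
apply: rst_trans (isotopic_step (u := [:: (0, Cup true); (1, Cup false); (2, Cross b)]%N)
  (v := [::]) _ _ (move_commute 0 0 Cap Cap)) _ => /=; try by case: b.
have := move_slide_cup 1 false (~~ b); rewrite negbK => m.
apply: rst_trans (isotopic_step_sym (u := [:: (0, Cup true)]%N)
  (v := [:: (2, Cap); (0, Cap)]%N) _ _ m) _ => /=; try by case: b {m}.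
by apply: (isotopic_step (u := [:: (0, Cup true)]%N)
  (v := [:: (0, Cap)]%N) _ _ (move_R1_right 1 false (~~ b))); case: b {m}.
Qed.

Lemma diagram_unknot : diagram unknot. Proof. by []. Qed.

(** The two branches of the minimum have opposite directions, so the positive crossing is the one
    with bit [false], and its smoothing is a maximum below a minimum: two circles. *)
Lemma conway_unknots : conway_triple 1 0 (kinked_unknot false)
  (kinked_unknot true) (unknot ++ reversed_unknot).
Proof.
apply: (@conway_tripleI unit [:: (0%N, CCup true tt)] [:: (0%N, CCap)] [::]
  (true, tt) (false, tt) [::] false) => //; by vm_compute.
Qed.

Section FieldIdentities.
Variable F : fieldType.
Implicit Types a x y : F.

Lemma common_denominator a x y m n : x != 0 -> y != 0 ->
  a / (x ^+ m * y ^+ n) = a * (x ^+ n * y ^+ m) / (x * y) ^+ (m + n).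
Proof.
move=> x0 y0; rewrite exprMn !exprD; field.
by rewrite !expf_neq0.
Qed.

Lemma skein_unknots x : x != 0 ->
  x ^ (-2) * 1 - x ^ 2 * 1 = (x - x^-1) * - (x + x^-1).
Proof. by move=> x0; rewrite -[x ^ (-2)]/(x ^- 2) -[x ^ 2]/(x ^+ 2); field. Qed.

Lemma skein_combination (c x y z u v w x' y' z' : F) :
  u * x - v * y = w * z -> u * x' - v * y' = w * z' ->
  u * (x + (x' - c * x)) - v * (y + (y' - c * y)) = w * (z + (z' - c * z)) :> F.
Proof.
move=> h h'.
transitivity ((u * x - v * y) + ((u * x' - v * y') - c * (u * x - v * y))).
  by ring.
by rewrite h h'; ring.
Qed.

End FieldIdentities.

Section Ratfun.
Variable R : realType.

Definition of_qpoly : {rmorphism {poly R[i]} -> ratfun R} :=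
  (@tofrac {poly {poly R[i]}}) \o polyC.

Definition of_qEpoly : {rmorphism {poly {poly R[i]}} -> ratfun R} :=
  @tofrac {poly {poly R[i]}}.

Lemma of_qpoly_eq0 p : (of_qpoly p == 0) = (p == 0).
Proof. by rewrite /= tofrac_eq0 polyC_eq0. Qed.

Lemma q_neq0 : q != 0 :> ratfun R.
Proof. by rewrite -[q]/(of_qpoly 'X) of_qpoly_eq0 polyX_eq0. Qed.

Lemma E_neq0 : E != 0 :> ratfun R.
Proof. by rewrite tofrac_eq0 polyX_eq0. Qed.

Lemma q_sub_qV_neq0 : q - q^-1 != 0 :> ratfun R.
Proof.
have : q * q - 1 != 0 :> ratfun R.
  rewrite -[q]/(of_qpoly 'X) -rmorphM -(rmorph1 of_qpoly) -rmorphB of_qpoly_eq0.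
  rewrite -size_poly_eq0 -expr2 -polyC1.
  by rewrite size_XnsubC.
apply: contra => /eqP h; have := q_neq0 => q0.
by rewrite -(mulfV q0) -mulrBr h mulr0.
Qed.

Lemma ratfun_natr_eq0 n : (n%:R == 0 :> ratfun R) = (n == 0)%N.
Proof. by rewrite -(rmorph_nat of_qpoly) of_qpoly_eq0 -polyC_natr polyC_eq0
  Num.Theory.pnatr_eq0. Qed.

Lemma laurent_qP (f : ratfun R) : laurent_q f <-> localized of_qpoly 'X f.
Proof. by split=> -[p [m ->]]; exists p, m. Qed.

Lemma of_qE_neq0 : of_qEpoly ('X%:P * 'X) != 0.
Proof. by rewrite rmorphM mulf_neq0 //; [apply: q_neq0|apply: E_neq0]. Qed.

Lemma laurent_qEP (f : ratfun R) :
  laurent_qE f <-> localized of_qEpoly ('X%:P * 'X) f.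
Proof.
split=> [[p [m [n ->]]]|[p [k ->]]].
  exists (p * ('X%:P ^+ n * 'X ^+ m)), (m + n)%N.
  rewrite !rmorphM !rmorphXn.
  by rewrite common_denominator; [|exact: q_neq0|exact: E_neq0].
by exists p, k, k; rewrite rmorphM exprMn.
Qed.

Lemma laurent_q_qE (f : ratfun R) : laurent_q f -> laurent_qE f.
Proof. by move=> [p [m ->]]; exists p%:P, m, 0; rewrite expr0 mulr1. Qed.

(** The value of the Jones polynomial on the unlink of two components: the two kinked unknots have
    value 1, and q^-2 - q^2 is (q - q^-1) times [delta]. *)
Definition delta : ratfun R := - (q + q^-1).

Lemma laurent_delta : localized of_qpoly 'X delta.
Proof.
apply: localizedN; apply: localizedD; first exact: q_neq0.
  exact: (localized_image of_qpoly 'X 'X).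
exact: localizedV.
Qed.

End Ratfun.

Section Jones.
Variables (R : realType) (V : word -> ratfun R).
Hypothesis hV : is_jones V.

Lemma jones_isotopic w w' : isotopic w w' -> V w = V w'.
Proof. by case: hV => -[_ h _ _] _ /h. Qed.

Lemma jones_skein t i Lp Lm L0 :
  conway_triple t i Lp Lm L0 -> skein V Lp Lm L0.
Proof. by case: hV => -[_ _ _ h] _; apply: h. Qed.

Lemma jones_laurent w : diagram w -> laurent_q (V w).
Proof. by case: hV => -[h _ _ _] _; apply: h. Qed.

Lemma jones_unknot : V unknot = 1.
Proof. by case: hV => -[]. Qed.

Lemma jones_two_unknots : V (unknot ++ unknot) = delta R.
Proof.
have := jones_skein conway_unknots; rewrite /skein.
rewrite !(jones_isotopic (kinked_unknotE _)) jones_unknot.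
have -> : V (unknot ++ reversed_unknot) = V (unknot ++ unknot).
  apply: jones_isotopic; apply: isotopic_cat_left => //.
  exact: rst_trans (rst_sym _ _ _ _ (kinked_reversed true)) (kinked_unknotE true).
move=> h; apply: (mulfI (@q_sub_qV_neq0 R)); rewrite -h.
exact: skein_unknots (@q_neq0 R).
Qed.

(* Adding a multiple of [f w - delta * V k * V w] to the Jones polynomial
   preserves the Jones rules when [f] is a skein invariant with the right value
   at the unknot; uniqueness then gives [f w = delta * V k * V w]. *)
Lemma jones_unique (f : word -> ratfun R) (c : ratfun R) :
  (forall w, diagram w -> laurent_q (f w)) -> laurent_q c ->
  isotopy_invariant f -> f unknot = c ->
  (forall t i Lp Lm L0, conway_triple t i Lp Lm L0 -> skein f Lp Lm L0) ->
  forall w, diagram w -> f w = c * V w.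
Proof.
move=> lf lc invf f1 sf w dw; have := proj2 hV (fun w => V w + (f w - c * V w)).
move=> H; suff /H/(_ w dw)/eqP : jones_rules (fun w => V w + (f w - c * V w)).
  by rewrite -subr_eq0 addrAC subrr add0r subr_eq0 => /eqP.
have q0 := @q_neq0 R; split.
- move=> v dv; have := jones_laurent dv; move: (lf _ dv) lc.
  rewrite !laurent_qP => h1 h2 h3; apply: localizedD => //.
  by apply: localizedD => //; apply: localizedN; apply: localizedM.
- by move=> v v' vv'; rewrite (jones_isotopic vv') (invf _ _ vv').
- by rewrite jones_unknot f1 mulr1 subrr addr0.
- move=> t i Lp Lm L0 ct; have := jones_skein ct; have := sf _ _ _ _ _ ct.
  rewrite /skein => sf' sV; exact: skein_combination sV sf'.
Qed.

(** Supplies the constant in [jones_cat]: there uniqueness in [w] reduces [V (k ++ w)] to its value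
    at [w = unknot], which is the present lemma applied to [k]. *)
Lemma jones_cat_unknot w : diagram w -> V (w ++ unknot) = delta R * V w.
Proof.
move: w; apply: (@jones_unique (fun w => V (w ++ unknot))).
- by move=> w dw; apply: jones_laurent; apply: diagram_cat.
- by apply/laurent_qP; apply: laurent_delta.
- by move=> w w' ww'; apply: jones_isotopic; apply: isotopic_cat_right.
- exact: jones_two_unknots.
- move=> t i Lp Lm L0 ct.
  have ru : crun (mono unknot) [::] = Some [::].
    by have := diagram_unknot; rewrite diagramE => /andP[_ /eqP].
  exact: jones_skein (@mono_conway [::] unknot _ _ _ _ _ erefl ru ct).
Qed.

Lemma jones_cat k w : diagram k -> diagram w -> V (k ++ w) = delta R * V k * V w.
Proof.
move=> dk; move: w; apply: (@jones_unique (fun w => V (k ++ w))).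
- by move=> w dw; apply: jones_laurent; apply: diagram_cat.
- apply/laurent_qP; apply: localizedM; first exact: laurent_delta.
  by apply/laurent_qP; apply: jones_laurent.
- by move=> w w' ww'; apply: jones_isotopic; apply: isotopic_cat_left.
- exact: jones_cat_unknot.
- move=> t i Lp Lm L0 ct.
  have rk : crun (mono k) [::] = Some [::].
    by have := dk; rewrite diagramE => /andP[_ /eqP].
  have := jones_skein (@mono_conway k [::] _ _ _ _ _ rk erefl ct).
  by rewrite !cats0.
Qed.

Lemma diagram_flatten ks : (0 < size ks)%N -> all diagram ks ->
  diagram (flatten ks).
Proof.
case: ks => // k ks _; elim: ks k => [|k' ks IH] k /=.
  by rewrite cats0 andbT.
by case/and3P => dk dk' dks; apply: diagram_cat => //; apply: IH; rewrite /= dk'.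
Qed.

Lemma jones_flatten ks : (0 < size ks)%N -> all diagram ks ->
  V (flatten ks) = delta R ^+ (size ks - 1) * \prod_(k <- ks) V k.
Proof.
case: ks => // k ks _; elim: ks k => [|k' ks IH] k /=.
  by rewrite cats0 andbT subnn expr0 mul1r big_seq1.
case/and3P => dk dk' dks; rewrite jones_cat //; last first.
  by apply: (@diagram_flatten (k' :: ks)) => //=; rewrite dk'.
rewrite (IH k') /= ?dk' // [in RHS]big_cons !subn1 /= exprS.
by rewrite -!mulrA; congr (_ * _); rewrite mulrCA.
Qed.

End Jones.

(** * The expansion over partitions *)

Definition separates (T : finType) (P : {set {set T}}) : rel T :=
  fun c d => pblock P c != pblock P d.

Lemma separates_sym (T : finType) (P : {set {set T}}) : symmetric (separates P).
Proof. by move=> c d; rewrite /separates eq_sym. Qed.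

Lemma separates_irr (T : finType) (P : {set {set T}}) : irreflexive (separates P).
Proof. by move=> c; rewrite /separates eqxx. Qed.

Lemma used_csub (T : eqType) (P : pred T) (w : cword T) st :
  used (csub P w st) = [seq c <- used w | P c].
Proof.
elim: w st => //= -[i e] w IH st; rewrite used_cat IH csub1_def /= /used /=.
by case: e => [o c||b] /=; case: ifP.
Qed.

(** A colour of [P] has to occur because the empty word is not a diagram. *)
Lemma csub_diagram (T : eqType) (P : pred T) (w : cword T) c : valid w ->
  c \in used w -> P c -> diagram (plainw (csub P w [::])).
Proof.
move=> vw uc Pc; apply: valid_diagram; last first.
  by apply/eqP; apply: (csub_run P (eqP vw)).
have : c \in used (csub P w [::]) by rewrite used_csub mem_filter Pc.
by case: csub.
Qed.

Lemma partition_block_color (T : finType) (P : {set {set T}}) (D B : {set T}) :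
  partition P D -> B \in P -> exists2 c, c \in D & c \in B.
Proof.
move=> pP BP; have : B != set0.
  by apply: contraTneq BP => ->; case/and3P: pP.
by case/set0Pn => c cB; exists c; rewrite // (subsetP (block_subset pP BP)).
Qed.

Lemma card_partition_bounds (T : finType) (P : {set {set T}}) (D : {set T}) :
  D != set0 -> partition P D -> (1 <= #|P| < #|D|.+1)%N.
Proof.
move=> /set0Pn[c cD] pP; rewrite (card_partition pP) card_gt0 ltnS; apply/andP; split.
  apply/set0Pn; exists (pblock P c); case/and3P: pP => /eqP cP _ _.
  by rewrite pblock_mem // cP.
rewrite -sum1_card; apply: leq_sum => B BP; rewrite card_gt0.
by have [d _ dB] := partition_block_color pP BP; apply/set0Pn; exists d.
Qed.

(** By [valid_factor], equal cardinals mean an injective recolouring of [canon]: the colours are the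
    components under other names. *)
Definition full (T : finType) (cw : cword T) : Prop :=
  [/\ diagram (plainw cw), valid cw & #|used_set cw| = #|components (plainw cw)|].

Lemma used_set_neq0 (T : finType) (cw : cword T) : diagram (plainw cw) ->
  valid cw -> used_set cw != set0.
Proof.
rewrite diagramE size_map => /andP[w0 _] vw; have [c uc] := valid_used w0 vw.
by apply/set0Pn; exists c; rewrite inE.
Qed.

Lemma full_canon w : diagram w -> full (canon w).
Proof.
by move=> dw; rewrite /full plainw_colorw used_set_canon //; split=> //; apply: canon_valid.
Qed.

Lemma leq_components w w' : diagram w -> diagram w' ->
  (forall (T : finType) (cw : cword T), plainw cw = w -> valid cw ->
     exists cw' : cword T, [/\ plainw cw' = w', valid cw' &
                               used_set cw' = used_set cw]) ->
  (#|components w| <= #|components w'|)%N.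
Proof.
move=> dw dw' h.
have [cw' [Ew' vw' Eu]] := h _ (canon w) (plainw_colorw _ _) (canon_valid dw).
by rewrite -used_set_canon -Eu; apply: leq_used_components.
Qed.

(** Runs ignore which strand passes over, so a crossing change keeps every colouring. *)
Lemma flip_coloring (T : finType) u i b b' v (cw : cword T) :
  plainw cw = u ++ (i, Cross b) :: v -> valid cw ->
  exists cw' : cword T, [/\ plainw cw' = u ++ (i, Cross b') :: v, valid cw' &
                            used_set cw' = used_set cw].
Proof.
move=> /plainw_eq_cat[cu [[|[j e] cv] [-> Eu]]] // [Ej Ee Ev]; subst j.
have -> : e = CCross b by case: e Ee => // c [->].
move=> /eqP; rewrite crun_cat; case ru: crun => [st|] //= rv.
exists (cu ++ (i, CCross b') :: cv); split.
- by rewrite plainw_cat Eu /= Ev.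
- apply/eqP; rewrite crun_cat ru /=; move: rv.
  case E: cstep => [st'|] //= rv.
  have [p [s [s' [-> /= -> Es Est']]]] := cstepP E.
  rewrite cstepE; case: s Es {E} => [|x [|y s]] //= [Es'].
  by rewrite -Es' in Est'; rewrite -Est'.
- by apply/setP => c; rewrite !inE !used_cat.
Qed.

Lemma moves_isotopic u v a b : diagram (u ++ a ++ v) -> diagram (u ++ b ++ v) ->
  moves a b -> isotopic (u ++ a ++ v) (u ++ b ++ v).
Proof.
move=> da db [->|[m|m]]; first exact: rst_refl.
  exact: isotopic_step.
exact: isotopic_step_sym.
Qed.

(** The two sides of the move lead from the same state to the same state, so everything outside is
    unaffected and the difference is confined to [equivalent_at]. The colour [c] keeps the sublinks
    nonempty. *)
Lemma transport_coloring (T : finType) u v a b (cw : cword T) : transports a b ->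
  diagram (u ++ b ++ v) -> plainw cw = u ++ a ++ v -> valid cw ->
  exists cw' : cword T,
  [/\ plainw cw' = u ++ b ++ v, valid cw', used_set cw' = used_set cw,
      forall r, symmetric r -> irreflexive r ->
        csum r cw' [::] = csum r cw [::]
    & forall (P : pred T) c, c \in used_set cw -> P c ->
        isotopic (plainw (csub P cw [::])) (plainw (csub P cw' [::]))].
Proof.
move=> tab; rewrite diagramE => /andP[_ vb].
move=> /plainw_eq_cat[cu [cav [-> Eu /plainw_eq_cat[ca [cv [-> Ea Ev]]]]]] vw.
have /eqP := vw; move/crun_cat_some => [st ru /crun_cat_some[st' ra rv]].
have rb : crun (mono b) (recolor_st (fun=> tt) st).
  move: vb; rewrite /valid !mono_cat crun_cat -Eu mono_plainw.
  by rewrite (crun_recolor _ ru) /= crun_cat; case: crun.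
have [cb [Eb rcb [ub1 ub2 cs sub]]] := tab T ca st st' Ea ra rb.
have su : {subset colors st <= used cu} by have := crun_colors ru.
have vw' : valid (cu ++ cb ++ cv) by rewrite /valid !crun_cat ru /= crun_cat rcb /= rv.
have Eused : used_set (cu ++ cb ++ cv) = used_set (cu ++ ca ++ cv).
  apply/setP => c; rewrite !inE !used_cat !mem_cat.
  apply/or3P/or3P => -[h|h|h]; try (by constructor 1); try by constructor 3.
    by have := ub2 _ h; rewrite mem_cat => /orP[/su h'|h']; [constructor 1|constructor 2].
  by have := ub1 _ h; rewrite mem_cat => /orP[/su h'|h']; [constructor 1|constructor 2].
exists (cu ++ cb ++ cv); split=> //.
- by rewrite !plainw_cat Eu Eb Ev.
- move=> r rs ri; rewrite !(csum_cat _ _ ru) (csum_cat _ _ rcb) (csum_cat _ _ ra).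
  by rewrite cs.
- move=> P c uc Pc.
  have d1 := csub_diagram vw _ Pc; have d2 := csub_diagram vw' _ Pc.
  move: d1 d2 => /(_ _)d1 /(_ _)d2.
  have {}d1 : diagram (plainw (csub P (cu ++ ca ++ cv) [::])).
    by apply: d1; rewrite inE in uc.
  have {}d2 : diagram (plainw (csub P (cu ++ cb ++ cv) [::])).
    by apply: d2; move: uc; rewrite -Eused inE.
  move: d1 d2; rewrite !(csub_cat _ _ ru) (csub_cat _ _ rcb) (csub_cat _ _ ra).
  by rewrite !plainw_cat => d1 d2; apply: moves_isotopic.
Qed.

Lemma diagram_move_transports w w' : diagram_move w w' ->
  [/\ diagram w, diagram w' & exists u a b v,
    [/\ w = u ++ a ++ v, w' = u ++ b ++ v, transports a b & transports b a]].
Proof.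
move=> [dw dw' [u [a [b [v [Ew Ew' /local_move_transports[tab tba]]]]]]].
by split=> //; exists u, a, b, v.
Qed.

(** Transport keeps the set of colours and works in both directions, so neither diagram has more
    components than the other. *)
Lemma card_components_move u v a b : transports a b -> transports b a ->
  diagram (u ++ a ++ v) -> diagram (u ++ b ++ v) ->
  #|components (u ++ a ++ v)| = #|components (u ++ b ++ v)|.
Proof.
move=> tab tba da db; apply/eqP; rewrite eqn_leq; apply/andP; split.
  apply: leq_components => // T cw Ew vw.
  by have [cw' [? ? ? _ _]] := transport_coloring tab db Ew vw; exists cw'.
apply: leq_components => // T cw Ew vw.
by have [cw' [? ? ? _ _]] := transport_coloring tba da Ew vw; exists cw'.
Qed.

Section Expansion.
Variables (R : realType) (V : word -> ratfun R).

Definition coefficient (k : nat) : ratfun R := delta R ^+ (k - 1) * Ek k.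

(** On the canonical colouring the signed sum is [2 * nu P], by [nu_canon], hence the exponent 2
    here where the formula has 4. *)
Definition term (T : finType) (cw : cword T) (P : {set {set T}}) : ratfun R :=
  coefficient #|P| * (q ^ (2 * csum (separates P) cw [::]) *
  \prod_(B in P) V (plainw (csub (mem B) cw [::]))).

Definition expansion (T : finType) (cw : cword T) : ratfun R :=
  \sum_(P : {set {set T}} | partition P (used_set cw)) term cw P.

Definition corollary_rhs (w : word) : ratfun R :=
  \sum_(1 <= k < #|components w|.+1)
    (-1) ^+ (k - 1) * (q + q^-1) ^+ (k - 1) * Ek k *
    \sum_(P : {set {set {set 'I_(size w)}}} |
          partition P (components w) && (#|P| == k)%N)
      q ^ (4 * nu P) * V_partition V P.

Lemma corollary_rhs_canon w : diagram w -> corollary_rhs w = expansion (canon w).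
Proof.
move=> dw; rewrite /corollary_rhs /expansion used_set_canon //.
under eq_bigr => k _.
  rewrite -exprMn mulN1r -/(delta R) -/(coefficient k) big_mkcondr /= mulr_sumr; over.
rewrite exchange_big /=; apply: eq_bigr => P pP.
transitivity (\sum_(1 <= k < #|components w|.+1 | k == #|P|)
    coefficient k * (q ^ (4 * nu P) * V_partition V P)).
  rewrite [RHS]big_mkcond /=; apply: eq_bigr => k _.
  by rewrite eq_sym; case: ifP; rewrite // mulr0.
rewrite big_nat1_eq card_partition_bounds //; last first.
  by rewrite -used_set_canon; apply: used_set_neq0; rewrite ?plainw_colorw ?canon_valid.
rewrite /term; congr (_ * (q ^ _ * _)).
  by rewrite -(nu_canon dw) mulrA.
apply: eq_bigr => B BP; rewrite (sublink_canon dw) //.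
exact: block_subset pP BP.
Qed.

Lemma csub_pull (T U : finType) (g : T -> U) (D : {set T}) (cu : cword T) st st'
    (B : {set U}) : crun cu st = Some st' ->
  {subset colors st ++ used cu <= D} ->
  csub (mem B) (recolor g cu) (recolor_st g st) =
  recolor g (csub (mem (pull g D B)) cu st).
Proof.
move=> ru sD; rewrite (csub_recolor g _ ru); congr recolor.
by apply: (csub_ext ru) => c /sD cD; rewrite /= mem_pull cD.
Qed.

Lemma csum_pull (T U : finType) (g : T -> U) (D : {set T}) (cu : cword T) st st'
    (Q : {set {set U}}) : crun cu st = Some st' ->
  {subset colors st ++ used cu <= D} -> partition Q (g @: D) ->
  csum (separates Q) (recolor g cu) (recolor_st g st) =
  csum (separates (pull_partition g D Q)) cu st.
Proof.
move=> ru sD pQ; rewrite (csum_recolor g _ ru).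
by apply: (csum_ext ru) => c d /sD cD /sD dD; rewrite /separates pblock_pull_eq.
Qed.

(** Every partition is compatible with an injective renaming, so [big_compatible] covers the whole
    sum. *)
Lemma expansion_recolor (T U : finType) (g : T -> U) (cw : cword T) :
  valid cw -> {in used_set cw &, injective g} ->
  expansion (recolor g cw) = expansion cw.
Proof.
move=> /eqP vw gi; rewrite /expansion used_set_recolor.
rewrite [RHS](eq_bigl (fun P =>
  partition P (used_set cw) && compatible g (used_set cw) P)); last first.
  by move=> P; rewrite compatible_inj // andbT.
have sD : {subset colors [::] ++ used cw <= used_set cw} by move=> c; rewrite inE.
rewrite big_compatible; apply: eq_bigr => Q pQ; rewrite /term card_pull_partition //.
rewrite (csum_pull vw sD pQ) big_pull_partition //.
congr (_ * (_ * _)); apply: eq_bigr => B _.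
by rewrite (csub_pull _ _ vw sD) plainw_recolor.
Qed.

Lemma corollary_rhs_full (T : finType) (cw : cword T) :
  full cw -> corollary_rhs (plainw cw) = expansion cw.
Proof.
move=> [dw vw cardE]; rewrite corollary_rhs_canon //.
have [g Ecw] := valid_factor dw erefl vw.
rewrite [in RHS]Ecw expansion_recolor //; first exact: canon_valid.
rewrite used_set_canon //; apply/imset_injP.
by rewrite -used_set_canon -used_set_recolor -Ecw used_set_canon // cardE.
Qed.

Hypothesis hV : is_jones V.

Lemma corollary_rhs_move w w' :
  diagram_move w w' -> corollary_rhs w = corollary_rhs w'.
Proof.
move=> /diagram_move_transports[dw dw' [u [a [b [v [Ew Ew' tab tba]]]]]]; subst w w'.
set w := u ++ a ++ v in dw *; pose cw := canon w.
have vw : valid cw by apply: canon_valid.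
have Ecw : plainw cw = w by apply: plainw_colorw.
have [cw' [Ecw' vw' Eu cs sub]] := transport_coloring tab dw' Ecw vw.
have full' : full cw'.
  split=> //; rewrite ?Ecw' // Eu used_set_canon //.
  exact: card_components_move.
rewrite -Ecw' (corollary_rhs_full full') (corollary_rhs_canon dw) /expansion Eu.
apply: eq_bigr => P pP; rewrite /term cs; last first.
- exact: separates_irr.
- exact: separates_sym.
congr (_ * (_ * _)); apply: eq_bigr => B BP.
have [c cD cB] := partition_block_color pP BP.
exact: (jones_isotopic hV (sub (mem B) c cD cB)).
Qed.

Lemma corollary_rhs_isotopic : isotopy_invariant corollary_rhs.
Proof.
move=> w w'; elim=> {w w'} [w w'|//|w w' _ //|w w' w'' _ -> _ -> //].
exact: corollary_rhs_move.
Qed.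

Lemma corollary_rhs_laurent w : diagram w -> laurent_qE (corollary_rhs w).
Proof.
move=> dw; rewrite corollary_rhs_canon //; apply/laurent_qEP.
have n0 := @of_qE_neq0 R.
have LQ (f : ratfun R) : laurent_q f -> localized (of_qEpoly R) ('X%:P * 'X) f.
  by move/laurent_q_qE/laurent_qEP.
have qL : localized (of_qEpoly R) ('X%:P * 'X) q.
  by apply: LQ; exists 'X, 0%N; rewrite expr0 divr1.
have qVL : localized (of_qEpoly R) ('X%:P * 'X) q^-1.
  by apply: LQ; exists 1, 1%N; rewrite expr1 polyC1 rmorph1 div1r.
have EVL : localized (of_qEpoly R) ('X%:P * 'X) E^-1.
  by apply/laurent_qEP; exists 1, 0%N, 1%N; rewrite expr0 mul1r expr1 rmorph1 div1r.
apply: localized_sum => // P pP; apply: localizedM; first apply: localizedM.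
- by apply: localizedX; apply: LQ; apply/laurent_qP; apply: laurent_delta.
- apply: localized_prod => j _; apply: localizedD => //; apply: localizedN.
  by rewrite -(rmorph_nat (of_qEpoly R)); apply: localized_image.
apply: localizedM.
  by case: (2 * _) => n; [|rewrite NegzE -exprnN -exprVn]; apply: localizedX.
apply: localized_prod => B BP; apply: LQ; apply: (jones_laurent hV).
have [c cD cB] := partition_block_color pP BP.
by apply: (@csub_diagram _ (mem B) _ c) => //; [apply: canon_valid|move: cD; rewrite inE].
Qed.

End Expansion.

(** * The skein relation *)

(** A single colour serves both strands: the maximum then accepts them, and the minimum restarts
    strands of the same colour. *)
Definition csmooth (T : Type) (i : nat) (dx dy : bool) (c : T) : cword T :=
  if dx == dy then [::] else [:: (i, CCap); (i, CCup dy c)].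

Lemma plainw_csmooth (T : Type) i dx dy (c : T) :
  plainw (csmooth i dx dy c) = smooth i dx dy.
Proof. by rewrite /csmooth /smooth; case: ifP. Qed.

Lemma crun_csmooth (T : eqType) (p s : cstate T) dx dy (c : T) :
  crun (csmooth (size p) dx dy c) (p ++ [:: (dx, c), (dy, c) & s]) =
  Some (p ++ [:: (dy, c), (dx, c) & s]).
Proof.
rewrite /csmooth; case: eqP => [->//|/eqP ne] /=.
rewrite cstepE /= ne eqxx /= cstepE /=.
by case: dx dy ne => -[].
Qed.

Lemma csub_csmooth (T : eqType) (P : pred T) (p s : cstate T) dx dy (c : T) :
  csub P (csmooth (size p) dx dy c) (p ++ [:: (dx, c), (dy, c) & s]) =
  if P c then csmooth (count (fun y => P y.2) p) dx dy c else [::].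
Proof.
rewrite /csmooth; case: eqP => [->|/eqP ne] /=; first by rewrite if_same.
by rewrite cstepE /= ne eqxx /= !csub1E /= andbb cats0; case: ifP.
Qed.

Lemma csum_csmooth (T : eqType) r (p s : cstate T) dx dy (c : T) :
  csum r (csmooth (size p) dx dy c) (p ++ [:: (dx, c), (dy, c) & s]) = 0.
Proof.
rewrite /csmooth; case: eqP => [->//|/eqP ne] /=.
by rewrite cstepE /= ne eqxx /= !csignE.
Qed.

Lemma distinct_colors w cu cv i b (p s : cstate {set 'I_(size w)}) x y :
  diagram w -> canon w = cu ++ (i, CCross b) :: cv ->
  crun cu [::] = Some (p ++ [:: x, y & s]) -> size p = i ->
  between_distinct_components w (size cu) -> x.2 != y.2.
Proof.
move=> dw Ecw ru sp /exists_inP[A cA /exists_inP[B cB /andP[nAB]]].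
have st : (size cu < size w)%N.
  have := size_colorw (@component w) w.
  rewrite -/(canon w) Ecw size_cat => /eq_leq; apply: leq_trans.
  by rewrite /= addnS ltnS leq_addr.
have Es : slice_at w (size cu) = (i, Cross b).
  have := nth_canon st; rewrite Ecw nth_cat ltnn subnn /= /paint.
  by case: slice_at => j [o||c] //= [-> ->].
have Est := crun_canon dw (ltnW st).
rewrite Ecw take_size_cat // ru in Est; case: Est => Est.
have lt_i : (i.+1 < size (level w (size cu)))%N.
  by rewrite -(size_recolor_st (@component w)) -Est size_cat sp /= !addnS !ltnS leq_addr.
have Ex : x.2 = component w (strand_at w (size cu) i).2.
  have := nth_map (true, 0%N) (true, x.2) (fun z => (z.1, component w z.2)) (ltnW lt_i).
  by rewrite -/(recolor_st _ _) -Est nth_cat sp ltnn subnn /= => ->.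
have Ey : y.2 = component w (strand_at w (size cu) i.+1).2.
  have := nth_map (true, 0%N) (true, x.2) (fun z => (z.1, component w z.2)) lt_i.
  by rewrite -/(recolor_st _ _) -Est nth_cat sp ltnNge leqnSn /= subSnn /= => ->.
have memi : strand_at w (size cu) i \in level w (size cu) by rewrite mem_nth // ltnW.
have memi1 : strand_at w (size cu) i.+1 \in level w (size cu) by rewrite mem_nth.
rewrite /crossing_between Es /= !(on_component dw _ (ltnW st)) // -Ex -Ey.
by apply: contraTneq => ->; case: eqP => [->|_]; rewrite ?(negPf nAB) ?andbF.
Qed.

(* Along the component of L+ through the first strand, the arc leaving the
   crossing comes back to the crossing, so that both strands of the smoothing
   get the same colour.  The count of the pairs of colours modulo 2 replaces
   this walk. *)
Lemma smoothing_colors (T U : eqType) (cu cv : cword T) (cu' cs' cv' : cword U)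
    p s x y st2 st3 :
  x.2 != y.2 ->
  crun cu [::] = Some (p ++ [:: x, y & s]) ->
  crun cv (p ++ [:: y, x & s]) = Some [::] ->
  plainw cu' = plainw cu -> plainw cv' = plainw cv ->
  plainw cs' = smooth (size p) x.1 y.1 ->
  crun cu' [::] = Some st2 -> crun cs' st2 = Some st3 ->
  crun cv' st3 = Some [::] ->
  exists p' s' c, [/\ size p' = size p, st2 = p' ++ [:: (x.1, c), (y.1, c) & s'],
    st3 = p' ++ [:: (y.1, c), (x.1, c) & s'] &
    {subset used cs' <= [:: c]}].
Proof.
move=> nxy ru rv Eu Ev Es ru' rs rv'.
(* Directions depend only on the underlying word, so the two runs have equally many strands, with
   the same directions, at the crossing. *)
have dirs : recolor_st (fun=> tt) st2 = recolor_st (fun=> tt) (p ++ [:: x, y & s]).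
  have := crun_recolor (fun=> tt) ru'; rewrite -mono_plainw Eu mono_plainw.
  by rewrite (crun_recolor (fun=> tt) ru) => -[].
have [p' [x' [y' [s' [Est2 sp ss dx dy]]]]] : exists p' x' y' s',
    [/\ st2 = p' ++ [:: x', y' & s'], size p' = size p, size s' = size s,
        x'.1 = x.1 & y'.1 = y.1].
  have sz : size st2 = (size p + (size s).+2)%N.
    by rewrite -(size_recolor_st (fun=> tt)) dirs size_recolor_st size_cat.
  exists (take (size p) st2).
  case Ed : (drop (size p) st2) => [|x' [|y' s']];
    have := congr1 size Ed; rewrite size_drop sz addKn //= => -[sds].
  exists x', y', s'; have sp : size (take (size p) st2) = size p.
    by rewrite size_takel // sz leq_addr.
  have [dx dy] : x'.1 = x.1 /\ y'.1 = y.1.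
    move/eqP: dirs; rewrite -(cat_take_drop (size p) st2) Ed !recolor_st_cat.
    by rewrite eqseq_cat ?size_recolor_st // => /andP[_ /eqP[-> -> _]].
  by split=> //; rewrite -Ed cat_take_drop.
have par a c : odd (pair_count a c (p ++ [:: x, y & s]) st2) = false.
  have sz0 : size ([::] : cstate T) = size ([::] : cstate U) by [].
  by have [_ <-] := crun_pair_parity a c (esym Eu) sz0 ru ru'.
have szu (z z' : bool * U) : size (p ++ [:: y, x & s]) = size (p' ++ [:: z, z' & s']).
  by rewrite !size_cat sp /= ss.
have par2 a c z z' : st3 = p' ++ [:: z, z' & s'] ->
    odd (pair_count a c (p ++ [:: y, x & s]) st3) = false.
  move=> E3; have sz3 : size (p ++ [:: y, x & s]) = size st3 by rewrite E3 (szu z z').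
  by have [_ ->] := crun_pair_parity a c (esym Ev) sz3 rv rv'.
(* Below the crossing the strand [x] faces [x']; above it, having moved one place to the right, it
   faces [z']. The pairs beside the crossing are unchanged, [y] has another colour than [x], and
   both counts are even, so [x'] and [z'] have the same colour. *)
have key c z z' : st3 = p' ++ [:: z, z' & s'] -> (c == x'.2) = (c == z'.2).
  move=> E3; have := par2 x.2 c _ _ E3; have := par x.2 c.
  rewrite E3 Est2 /pair_count !zip_cat // !count_cat /= !oddD.
  rewrite [y.2 == x.2]eq_sym (negPf nxy) eqxx /= !oddb.
  rewrite [c == _]eq_sym [c == z'.2]eq_sym.
  by case: (odd _) => /=; case: (odd _) => /=; case: eqP; case: eqP.
exists p', s', x'.2; move: rs Es; rewrite /smooth; case: ifP => [/eqP dxy|/negbT dxy].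
  case: cs' => //= -[E3] _; rewrite -E3 in key *.
  have /esym/eqP yx := key x'.2 x' y' Est2; rewrite eqxx in yx.
  have Exy : x' = y'.
    by rewrite [x']surjective_pairing [y']surjective_pairing yx dx dy dxy.
  by split=> //; rewrite Est2 -Exy -dxy -dx -surjective_pairing.
case: cs' => [|[i1 e1] [|[i2 e2] [|? ?]]] //= rs [Ei1 Ee1 Ei2 Ee2].
move: rs; rewrite Ei1 Ei2 -sp Est2.
case: e1 Ee1 => // _; case: e2 Ee2 => // o c [Eo]; rewrite Eo cstepE /=.
case: ifP => //= /andP[_ /eqP exy]; rewrite cstepE /= => -[E3].
have := key x'.2 _ _ (esym E3); rewrite eqxx /= => /esym/eqP xc.
split=> //.
- by rewrite -dx -dy {2}exy -!surjective_pairing.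
- by rewrite -E3 xc; case: x.1 y.1 dxy => -[] // [].
- by rewrite -xc.
Qed.

Definition merge (T : eqType) (a b c : T) : T := if c == b then a else c.

Lemma merge_left (T : eqType) (a b : T) : merge a b a = a.
Proof. by rewrite /merge if_same. Qed.

Lemma merge_right (T : eqType) (a b : T) : merge a b b = a.
Proof. by rewrite /merge eqxx. Qed.

Lemma colors_used_prefix (T : eqType) (cu : cword T) st x :
  crun cu [::] = Some st -> x \in st -> x.2 \in used cu.
Proof. by move=> /crun_colors h xs; apply: h; apply: map_f. Qed.

(** When [L0] is coloured by its components, [smoothing_colors] allows the crossing to be put back.
    The colouring so obtained is [recolor h cw], where [h] agrees on the two colours of the
    crossing; hence [h] factors through [merge], and no component of [L0] is missed. *)
Lemma leq_components_smoothing (T : finType) (cu cv : cword T) p s x y b :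
  let cw := cu ++ (size p, CCross b) :: cv in
  let L0 := plainw cu ++ smooth (size p) x.1 y.1 ++ plainw cv in
  diagram L0 ->
  crun cu [::] = Some (p ++ [:: x, y & s]) ->
  crun cv (p ++ [:: y, x & s]) = Some [::] ->
  x.2 != y.2 ->
  (forall (U : finType) (cw' : cword U), plainw cw' = plainw cw -> valid cw' ->
    exists h, cw' = recolor h cw) ->
  (#|components L0| <= #|merge x.2 y.2 @: used_set cw|)%N.
Proof.
move=> cw L0 dL0 ru rv nxy factor.
have := canon_valid dL0; have := plainw_colorw (@component L0) L0.
rewrite -/(canon L0) -(used_set_canon L0).
move: (canon L0) => cw0 /plainw_eq_cat[cu' [csv [-> Eu']]].
move=> /plainw_eq_cat[cs' [cv' [-> Es' Ev']]].
move=> /eqP/crun_cat_some[st2 ru' /crun_cat_some[st3 rs rv']].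
have [p' [s' [c [sp' E2 E3 uc]]]] := smoothing_colors nxy ru rv Eu' Ev' Es' ru' rs rv'.
pose cw' := cu' ++ (size p, CCross b) :: cv'.
have vcw' : valid cw'.
  by rewrite /valid crun_cat ru' E2 /= -sp' cstepE /= -E3 rv'.
have Ecw' : plainw cw' = plainw cw by rewrite /cw' /cw !plainw_cat /= Eu' Ev'.
have [h Eh] := factor _ _ Ecw' vcw'.
have scu : size cu' = size cu.
  by rewrite -(size_map (@plain _)) -/(plainw _) Eu' size_map.
have hu : cu' = recolor h cu.
  have := congr1 (take (size cu')) Eh; rewrite /cw' take_size_cat //.
  by rewrite recolor_cat scu take_size_cat ?size_map.
have hv : cv' = recolor h cv.
  have := congr1 (drop (size cu')) Eh; rewrite /cw' drop_size_cat //.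
  by rewrite recolor_cat scu drop_size_cat ?size_map // => -[].
have [hx hy] : h x.2 = c /\ h y.2 = c.
  have := crun_recolor h ru; rewrite -hu ru' E2 recolor_st_cat => -[/eqP].
  by rewrite eqseq_cat ?size_recolor_st // => /andP[_ /eqP[-> -> _]].
have hg d : h (merge x.2 y.2 d) = h d.
  by rewrite /merge; case: eqP => // ->; rewrite hx hy.
have xu : x.2 \in used cu.
  by apply: (colors_used_prefix ru); rewrite mem_cat mem_head orbT.
apply: leq_trans (leq_imset_card h _); apply: subset_leq_card.
apply/subsetP => d; rewrite inE !used_cat !mem_cat hu hv !used_recolor.
have img d0 : d0 \in used cw -> h d0 \in h @: (merge x.2 y.2 @: used_set cw).
  by move=> ud; rewrite -hg !imset_f // inE.
case/or3P => [/mapP[d0 ud ->]|/uc|/mapP[d0 ud ->]].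
- by apply: img; rewrite used_cat mem_cat ud.
- by rewrite inE => /eqP ->; rewrite -hx; apply: img; rewrite used_cat mem_cat xu.
- by apply: img; rewrite used_cat mem_cat [_ \in used cv]ud orbT.
Qed.

Lemma crossing_change (n : int) (b : bool) :
  n + (if b == b then 1 else -1) = n + (if ~~ b == b then 1 else -1) + 2.
Proof. by case: b => /=; lia. Qed.

Lemma skein_product (F : fieldType) (u v w k c x y z r : F) :
  u * x - v * y = w * z ->
  u * (k * (c * (x * r))) - v * (k * (c * (y * r))) = w * (k * (c * (z * r))).
Proof.
move=> h; transitivity ((u * x - v * y) * (k * c * r)); first by ring.
by rewrite h; ring.
Qed.

(** Both sides carry [x] to the power 2n + 2. *)
Lemma skein_cancel (F : fieldType) (x : F) (m n : int) k r : x != 0 -> m = n + 2 ->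
  x ^ (-2) * (k * (x ^ (2 * m) * r)) = x ^ 2 * (k * (x ^ (2 * n) * r)).
Proof.
move=> x0 ->; have e : x ^ (-2) * x ^ (2 * (n + 2)) = x ^ 2 * x ^ (2 * n).
  by rewrite -!expfzDr //; congr exprz; lia.
by rewrite mulrCA [RHS]mulrCA; congr (k * _); rewrite mulrA e [RHS]mulrA.
Qed.

Section Skein.
Variables (R : realType) (V : word -> ratfun R).
Hypothesis hV : is_jones V.

Lemma corollary_rhs_skein t i Lp Lm L0 : conway_triple t i Lp Lm L0 ->
  between_distinct_components Lp t -> skein (corollary_rhs V) Lp Lm L0.
Proof.
move=> ct bt; have dLp : diagram Lp by case: ct => u [v [b [_ []]]].
have [cu [cv [p [x [y [s [b [ru rv pos [[st sp] Ew] [ELm EL0]]]]]]]]] :=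
  conway_tripleE ct (plainw_colorw (@component Lp) Lp) (canon_valid dLp).
rewrite -/(canon Lp) in Ew.
have nxy : x.2 != y.2.
  by rewrite -st in bt; apply: distinct_colors dLp Ew ru sp bt.
pose cw b' := cu ++ (size p, CCross b') :: cv.
have Ewp : canon Lp = cw b by rewrite /cw sp.
have ELp : plainw (cw b) = Lp by rewrite -Ewp plainw_colorw.
have vcw b' : valid (cw b').
  by rewrite /valid crun_cat ru /= cstepE /= rv.
have ucw b' : used_set (cw b') = used_set (cw b).
  by apply/setP => c; rewrite !inE !used_cat.
have dcw b' : diagram (plainw (cw b')).
  by apply: valid_diagram; rewrite ?vcw // size_cat addnS.
set a := x.2 in nxy *; set a' := y.2 in nxy *.
set D := used_set (cw b).
have ua : a \in used cu.
  by apply: (colors_used_prefix ru); rewrite mem_cat mem_head orbT.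
have ua' : a' \in used cu.
  by apply: (colors_used_prefix ru); rewrite mem_cat !inE eqxx !orbT.
have uD c : c \in used cu -> c \in D by move=> h; rewrite inE used_cat mem_cat h.
have fullp : full (cw b) by rewrite -Ewp; apply: full_canon.
have fullm : full (cw (~~ b)).
  split=> //; rewrite ucw; case: fullp => _ _ ->.
  have flip b1 b2 : (#|components (plainw (cw b1))| <= #|components (plainw (cw b2))|)%N.
    apply: leq_components => // T cw0 E0 v0.
    rewrite plainw_cat /= in E0; have [cw1 [E1 v1 u1]] := flip_coloring b2 E0 v0.
    by exists cw1; rewrite E1 plainw_cat.
  by apply/eqP; rewrite eqn_leq !flip.
pose g := merge a a'.
(* The smoothing joins the two components that cross, so their colours are merged. *)
pose cw0 := recolor g cu ++ csmooth (size p) x.1 y.1 a ++ recolor g cv.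
have ru0 : crun (recolor g cu) [::] =
    Some (recolor_st g p ++ [:: (x.1, a), (y.1, a) & recolor_st g s]).
  rewrite (crun_recolor g ru) recolor_st_cat /=.
  by rewrite -/a -/a' /g merge_left merge_right.
have st0E : recolor_st g (p ++ [:: y, x & s]) =
    recolor_st g p ++ [:: (y.1, a), (x.1, a) & recolor_st g s].
  by rewrite recolor_st_cat /= -/a -/a' /g merge_left merge_right.
have rv0 : crun (recolor g cv)
    (recolor_st g p ++ [:: (y.1, a), (x.1, a) & recolor_st g s]) = Some [::].
  by rewrite -st0E (crun_recolor g rv).
have rs0 : crun (csmooth (size p) x.1 y.1 a)
    (recolor_st g p ++ [:: (x.1, a), (y.1, a) & recolor_st g s]) =
    Some (recolor_st g p ++ [:: (y.1, a), (x.1, a) & recolor_st g s]).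
  by rewrite -(size_recolor_st g p) crun_csmooth.
have vcw0 : valid cw0 by rewrite /valid crun_cat ru0 /= crun_cat rs0 /= rv0.
have Ecw0 : plainw cw0 = L0.
  by rewrite /cw0 !plainw_cat !plainw_recolor plainw_csmooth EL0 -sp.
have ucw0 : used_set cw0 = g @: D.
  apply/setP => c; rewrite inE !used_cat !mem_cat !used_recolor.
  apply/or3P/imsetP => [[/mapP[d ud ->]|us|/mapP[d ud ->]]|[d]].
  - by exists d; rewrite ?uD.
  - exists a; rewrite ?uD // /g merge_left; move: us; rewrite /csmooth.
    by case: ifP => //= _; rewrite inE => /eqP.
  - by exists d; rewrite // inE used_cat mem_cat [_ \in used ((_, _) :: _)]ud orbT.
  - rewrite inE used_cat mem_cat => /orP[ud|ud] ->.
      by constructor 1; apply: map_f.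
    by constructor 3; apply: map_f.
have dL0 : diagram L0.
  rewrite -Ecw0; apply: valid_diagram => //.
  have : g a \in used cw0 by rewrite -[_ \in _]inE -/(used_set cw0) ucw0 imset_f ?uD.
  by case: (cw0).
(* There are at least as many components as colours because [cw0] is valid, and at most as many by
   putting the crossing back. *)
have full0 : full cw0.
  split; rewrite ?Ecw0 //; apply/eqP; rewrite eqn_leq ucw0; apply/andP; split.
    by rewrite -ucw0; apply: leq_used_components.
  rewrite EL0 -sp; apply: (leq_components_smoothing _ ru rv nxy).
    by rewrite sp -EL0.
  move=> U cw' Ecw' vcw'; rewrite -/(cw b) -Ewp; apply: valid_factor => //.
  by rewrite Ecw' ELp.
have Fp : corollary_rhs V Lp = expansion V (cw b).
  by have := corollary_rhs_full V fullp; rewrite ELp.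
have Fm : corollary_rhs V Lm = expansion V (cw (~~ b)).
  by rewrite ELm -(corollary_rhs_full V fullm).
have F0 : corollary_rhs V L0 = expansion V cw0.
  by have := corollary_rhs_full V full0; rewrite Ecw0.
rewrite /skein Fp Fm F0 /expansion ucw ucw0 -/D.
have csum_cw r b' : csum r (cw b') [::] =
    csum r cu [::] + csum r cv (p ++ [:: y, x & s]) +
    (if r a a' then if b' == b then 1 else -1 else 0).
  rewrite (csum_cat _ _ ru) /= csignE /= cstepE /= -(eqP pos) -addrA.
  by congr (_ + _); rewrite addrC.
have csub_cw (P : pred {set 'I_(size Lp)}) b' : P a = P a' ->
    plainw (csub P (cw b') [::]) = plainw (csub P cu [::] ++
      (if P a then [:: (count (fun z => P z.2) p, CCross b')] else [::]) ++
      csub P cv (p ++ [:: y, x & s])).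
  move=> Pa; rewrite (csub_cat _ _ ru) /= csub1E /= cstepE /= -/a -/a' -Pa andbb.
  by [].
have csub_cw0 (P : pred {set 'I_(size Lp)}) b' : ~~ (P a && P a') ->
    plainw (csub P (cw b') [::]) =
    plainw (csub P cu [::] ++ csub P cv (p ++ [:: y, x & s])).
  move=> nP; rewrite (csub_cat _ _ ru) /= csub1E /= cstepE /= -/a -/a'.
  by rewrite (negPf nP).
have noncompatible :
    q ^ (-2) * \sum_(P | partition P D && ~~ compatible g D P) term V (cw b) P =
    q ^ 2 * \sum_(P | partition P D && ~~ compatible g D P) term V (cw (~~ b)) P.
  rewrite !mulr_sumr; apply: eq_bigr => P /andP[pP ncP].
  (* [g] identifies no colours except [a] and [a'], so an incompatible partition separates these
     two. *)
  have sep : pblock P a != pblock P a'.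
    apply: contra ncP => /eqP eP; apply/compatibleP => c d cD dD.
    rewrite /g /merge; do 2 (case: eqP => [->|_]);
      by first [done | move=> -> | move=> <-].
  rewrite /term.
  have -> : \prod_(B in P) V (plainw (csub (mem B) (cw b) [::])) =
            \prod_(B in P) V (plainw (csub (mem B) (cw (~~ b)) [::])).
    (* No block contains both colours: the crossing is erased from every sublink. *)
    apply: eq_bigr => B BP; have nB : ~~ ((a \in B) && (a' \in B)).
      apply: contra sep => /andP[aB a'B].
      by have /and3P[_ tP _] := pP; rewrite !(def_pblock tP BP).
    by rewrite !csub_cw0.
  apply: skein_cancel; first exact: q_neq0.
  by rewrite !csum_cw /separates sep; apply: crossing_change.
(* The incompatible terms of [Lp] and [Lm] cancel; the compatible ones are indexed, like the sum for
   [L0], by the partitions of the merged colours. *)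
rewrite (bigID (compatible g D)) [X in _ - _ * X](bigID (compatible g D)) /=.
have cancel (u v n : ratfun R) : u + n - (v + n) = u - v.
  by rewrite opprD addrACA subrr addr0.
rewrite !mulrDr noncompatible cancel !big_compatible.
rewrite !mulr_sumr -sumrB; apply: eq_bigr => Q pQ.
rewrite /term !card_pull_partition // !big_pull_partition //.
have sDu : {subset colors [::] ++ used cu <= D} by move=> c; apply: uD.
have sDv : {subset colors (p ++ [:: y, x & s]) ++ used cv <= D}.
  move=> c; rewrite mem_cat => /orP[/mapP[z zst ->]|uc]; last first.
    by rewrite inE used_cat mem_cat [_ \in used ((_, _) :: _)]uc orbT.
  apply/uD/(colors_used_prefix ru); move: zst; rewrite !mem_cat !inE.
  by case/or4P => ->; rewrite ?orbT.
have gaD : a \in g @: D by rewrite -{1}(merge_left a a') imset_f ?uD.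
have cvp : g a = g a' by rewrite /g merge_left merge_right.
have csum0 : csum (separates Q) cw0 [::] =
    csum (separates (pull_partition g D Q)) cu [::] +
    csum (separates (pull_partition g D Q)) cv (p ++ [:: y, x & s]).
  rewrite /cw0 (csum_cat _ _ ru0) (csum_cat _ _ rs0).
  rewrite -{1}(size_recolor_st g p) csum_csmooth add0r -st0E.
  by rewrite (csum_pull ru sDu pQ) (csum_pull rv sDv pQ).
(* The crossing now lies inside a block and does not count, so the power of q is the same for the
   three diagrams. *)
have sep0 : separates (pull_partition g D Q) a a' = false.
  apply/negbTE; rewrite negbK pblock_pull_eq ?uD //.
  by rewrite cvp.
rewrite !csum_cw sep0 addr0 -csum0.
have memP B : (a \in pull g D B) = (a \in B).
  by rewrite mem_pull uD // /g merge_left.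
have memP' B : (a' \in pull g D B) = (a \in B).
  by rewrite mem_pull uD // /g merge_right.
have sub0 (B : {set {set 'I_(size Lp)}}) : plainw (csub (mem B) cw0 [::]) =
    plainw (csub (mem (pull g D B)) cu [::]) ++
    (if a \in B
     then smooth (count (fun z => z.2 \in pull g D B) p) x.1 y.1 else [::]) ++
    plainw (csub (mem (pull g D B)) cv (p ++ [:: y, x & s])).
  rewrite /cw0 (csub_cat _ _ ru0) (csub_cat _ _ rs0).
  rewrite -{1}(size_recolor_st g p) csub_csmooth -st0E.
  rewrite (csub_pull _ _ ru sDu) (csub_pull _ _ rv sDv) !plainw_cat !plainw_recolor.
  congr (_ ++ (_ ++ _)); rewrite -![mem B a]/(a \in B); case: (a \in B) => //.
  rewrite plainw_csmooth count_map; congr smooth.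
  apply: eq_in_count => z zp /=; rewrite mem_pull sDv //.
  by rewrite mem_cat map_f // mem_cat zp.
(* The block of the merged colour. Only its sublink contains the crossing; the factors of the other
   blocks are common to the three diagrams. *)
set B0 := pblock Q a; have /and3P[/eqP cQ tQ _] := pQ.
have B0Q : B0 \in Q by rewrite pblock_mem // cQ.
have aB0 : a \in B0 by rewrite mem_pblock cQ.
rewrite !(bigD1 B0 B0Q) /=.
have rest b' : \prod_(B in Q | B != B0) V (plainw (csub (mem (pull g D B)) (cw b') [::])) =
    \prod_(B in Q | B != B0) V (plainw (csub (mem B) cw0 [::])).
  apply: eq_bigr => B /andP[BQ nB].
  have naB : a \notin B by apply: contra nB => aB; rewrite /B0 (def_pblock tQ BQ).
  by rewrite csub_cw0 /= ?memP ?(negPf naB) // sub0 (negPf naB) plainw_cat.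
rewrite !rest; apply: skein_product.
rewrite !csub_cw /= ?memP ?memP' // aB0 sub0 aB0.
have xB : x.2 \in pull g D B0 by rewrite memP.
have yB : y.2 \in pull g D B0 by rewrite memP'.
(* Erasure commutes with running, which exhibits the three sublinks of [B0] as a Conway triple. *)
have := csub_run (mem (pull g D B0)) ru; have := csub_run (mem (pull g D B0)) rv.
rewrite !filter_cat /= xB yB -size_filter => rv1 ru1.
have := jones_skein hV (conway_tripleI ru1 rv1 pos).
by rewrite !plainw_cat.
Qed.

End Skein.

(** * Split unions of knots *)

Lemma csub_predT (T : eqType) (w : cword T) st st' :
  crun w st = Some st' -> csub predT w st = w.
Proof.
elim: w st => [|[i e] w IH] st //=.
case E: cstep => [st1|] //= /IH ->.
have [p [s [s' [-> /= -> Es _]]]] := cstepP E.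
rewrite csub1E count_predT (_ : kept predT e s) //.
by case: e s Es {E} => [o c||b] [|x [|y s]].
Qed.

Lemma csub_pred0 (T : eqType) (w : cword T) st : csub pred0 w st = [::].
Proof.
elim: w st => //= -[i e] w IH st; rewrite IH csub1_def cats0 /=.
by case: e => [o c||b] //=; case: drop => [|x [|y s]].
Qed.

Lemma csum_false (T : eqType) (w : cword T) st : csum (fun _ _ => false) w st = 0.
Proof.
elim: w st => //= -[i e] w IH st; rewrite IH csign_def addr0 /=.
by case: e => [o c||b] //=; case: drop => [|x [|y s]].
Qed.

(* Applied to the canonical colouring, this bounds the number of components. *)
Lemma leq_used_split_union (T : finType) ks (cw : cword T) :
  all knot ks -> plainw cw = split_union ks -> valid cw ->
  (#|used_set cw| <= size ks)%N.
Proof.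
elim: ks cw => [|k ks IH] cw /=.
  case: cw => [_ _ _|//].
  have -> : used_set ([::] : cword T) = set0 by apply/setP => c; rewrite !inE.
  by rewrite cards0.
case/andP=> /andP[dk /eqP k1] aks /plainw_eq_cat[cu [cv [-> Eu Ev]]] /eqP.
move=> /crun_cat_some[st ru rv].
(* The first knot diagram ends at the empty level, so it and the rest are coloured independently. *)
have st0 : st = [::].
  move: dk; rewrite diagramE => /andP[_ /eqP].
  rewrite -Eu mono_plainw (crun_recolor _ ru) => -[] /(congr1 size).
  by rewrite size_recolor_st; case: st {ru rv}.
rewrite st0 in ru rv.
have -> : used_set (cu ++ cv) = used_set cu :|: used_set cv.
  by apply/setP => c; rewrite !inE used_cat mem_cat.
apply: leq_trans (leq_card_setU _ _) _; rewrite -add1n leq_add //.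
  by rewrite -k1; apply: leq_used_components => //; apply/eqP.
by apply: IH => //; apply/eqP.
Qed.

Section SplitUnion.
Variable ks : seq word.
Hypotheses (ks_gt0 : (0 < size ks)%N) (knots : all knot ks).

Lemma split_component_diagram (j : 'I_(size ks)) : diagram (nth [::] ks j).
Proof.
by have /andP[] : knot (nth [::] ks j) by move/all_nthP: knots; apply.
Qed.

Definition monochrome (j : 'I_(size ks)) : cword 'I_(size ks) :=
  recolor (fun=> j) (mono (nth [::] ks j)).

(** Defined for any list of indices, so that erasing colours gives a word of the same form. *)
Definition split_coloring (js : seq 'I_(size ks)) : cword 'I_(size ks) :=
  flatten [seq monochrome j | j <- js].

Lemma crun_monochrome j : crun (monochrome j) [::] = Some [::].
Proof.
have := split_component_diagram j; rewrite diagramE => /andP[_ /eqP h].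
exact: (crun_recolor (fun=> j) h).
Qed.

Lemma crun_split_coloring js : crun (split_coloring js) [::] = Some [::].
Proof.
elim: js => //= j js IH.
by rewrite /split_coloring /= crun_cat crun_monochrome.
Qed.

Lemma csub_split_coloring (P : pred 'I_(size ks)) js :
  csub P (split_coloring js) [::] = split_coloring [seq j <- js | P j].
Proof.
elim: js => //= j js IH.
rewrite /split_coloring /= (csub_cat _ _ (crun_monochrome j)).
rewrite -/(split_coloring js) IH.
have := split_component_diagram j; rewrite diagramE => /andP[_ /eqP h].
rewrite [csub P _ _](csub_recolor (fun=> j) P h).
case: ifP => Pj.
  by rewrite (_ : csub _ _ _ = csub predT (mono (nth [::] ks j)) [::]) ?(csub_predT h) //;
     apply: (csub_ext h).
by rewrite (_ : csub _ _ _ = csub pred0 (mono (nth [::] ks j)) [::]) ?csub_pred0 //;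
   apply: (csub_ext h).
Qed.

Lemma csum_split_coloring (r : rel 'I_(size ks)) js : irreflexive r ->
  csum r (split_coloring js) [::] = 0.
Proof.
move=> ri; elim: js => //= j js IH.
rewrite /split_coloring /= (csum_cat _ _ (crun_monochrome j)).
rewrite -/(split_coloring js) IH addr0.
have := split_component_diagram j; rewrite diagramE => /andP[_ /eqP h].
rewrite [csum r _ _](csum_recolor (fun=> j) r h).
by rewrite -(csum_false (mono (nth [::] ks j)) [::]); apply: (csum_ext h).
Qed.

Lemma plainw_split_coloring js :
  plainw (split_coloring js) = flatten [seq nth [::] ks (val j) | j <- js].
Proof.
elim: js => //= j js IH.
by rewrite /split_coloring /= plainw_cat IH plainw_recolor plain_mono.
Qed.

Lemma plainw_split_coloring_enum :
  plainw (split_coloring (enum 'I_(size ks))) = split_union ks.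
Proof.
rewrite plainw_split_coloring /split_union; congr flatten.
by rewrite (map_comp (nth [::] ks)) val_enum_ord -[RHS](mkseq_nth [::]).
Qed.

Lemma used_set_split_coloring :
  used_set (split_coloring (enum 'I_(size ks))) = setT.
Proof.
apply/setP => j; rewrite !inE.
have [c uc] : exists c, c \in used (monochrome j).
  apply: valid_used; last by apply/eqP/crun_monochrome.
  rewrite !size_map; have := split_component_diagram j.
  by rewrite diagramE => /andP[].
have -> : j = c.
  by move: uc; rewrite used_recolor => /mapP[].
have : j \in enum 'I_(size ks) by rewrite mem_enum.
elim: (enum _) => //= i js IH; rewrite /split_coloring /= used_cat mem_cat inE.
by case/orP => [/eqP <-|/IH ->]; rewrite ?uc ?orbT.
Qed.

(** There are [size ks] colours, and [leq_used_split_union] applied to [canon] shows that there are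
    no more components. *)
Lemma full_split_coloring : full (split_coloring (enum 'I_(size ks))).
Proof.
have vcw : valid (split_coloring (enum 'I_(size ks))) by apply/eqP/crun_split_coloring.
have dks : diagram (split_union ks).
  by apply: diagram_flatten => //; apply: sub_all knots => k /andP[].
rewrite /full plainw_split_coloring_enum; split=> //; apply/eqP.
rewrite eqn_leq leq_used_components ?plainw_split_coloring_enum //.
rewrite used_set_split_coloring cardsT card_ord -(used_set_canon (split_union ks)).
by apply: leq_used_split_union; rewrite ?plainw_colorw ?canon_valid.
Qed.

End SplitUnion.

(** The total exponent of [delta] coming from the blocks, since a split union of m knots contributes
    the power m - 1. *)
Lemma sum_card_pred (T : finType) (P : {set {set T}}) : partition P setT ->
  (\sum_(B in P) (#|B| - 1) = #|T| - #|P|)%N.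
Proof.
move=> pP; have B0 B : B \in P -> (0 < #|B|)%N.
  by move=> /(partition_block_color pP)[c _ cB]; apply/card_gt0P; exists c.
by rewrite sumnB // -(card_partition pP) cardsT sum1_card.
Qed.

(** This is [sum_partition_falling] divided by [x]: [Ek] lacks the factor of index 0, which each
    falling factorial contains because a partition of a nonempty set has a block. *)
Lemma sum_partition_falling_pred (F : fieldType) (T : finType) (x : F) :
  (0 < #|T|)%N -> x != 0 ->
  (forall n, (n%:R == 0 :> F) = (n == 0)%N) ->
  \sum_(P : {set {set T}} | partition P setT) \prod_(1 <= j < #|P|) (x - j%:R)
  = x ^+ (#|T| - 1).
Proof.
move=> T0 x0 char0; apply: (mulfI x0); rewrite -exprS subn1 prednK //.
rewrite -(sum_partition_falling T x char0) mulr_sumr; apply: eq_bigr => P pP.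
have := card_partition_bounds _ pP; rewrite -card_gt0 cardsT => /(_ T0)/andP[P0 _].
by rewrite [RHS]big_ltn // subr0.
Qed.

Section Theta.
Variables (R : realType) (V : word -> ratfun R).
Hypothesis hV : is_jones V.

Lemma corollary_rhs_split_union ks : (0 < size ks)%N -> all knot ks ->
  corollary_rhs V (split_union ks) =
  E ^ (1 - (size ks)%:Z) * V (split_union ks).
Proof.
move=> ks0 knots; have dks : all diagram ks by apply: sub_all knots => k /andP[].
have fcw := full_split_coloring ks0 knots.
have := corollary_rhs_full V fcw; rewrite plainw_split_coloring_enum => ->.
rewrite /expansion used_set_split_coloring //.
pose Pi := \prod_(k <- ks) V k.
have PiE : Pi = \prod_(j < size ks) V (nth [::] ks j).
  by rewrite /Pi (big_nth [::]) big_mkord.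
(* The power of [delta] leaves the sum: it is [#|P| - 1] from the coefficient plus [size ks - #|P|]
   from the blocks. *)
transitivity (delta R ^+ (size ks - 1) * Pi *
  \sum_(P : {set {set 'I_(size ks)}} | partition P setT) Ek #|P|).
  rewrite mulr_sumr; apply: eq_bigr => P pP; rewrite /term.
  rewrite csum_split_coloring //; last exact: separates_irr.
  rewrite mulr0 expr0z mul1r /coefficient.
  have -> : \prod_(B in P) V (plainw (csub (mem B)
              (split_coloring (enum 'I_(size ks))) [::])) =
            delta R ^+ (size ks - #|P|) * Pi.
    have VB (B : {set 'I_(size ks)}) : B \in P ->
        V (plainw (csub (mem B) (split_coloring (enum 'I_(size ks))) [::])) =
        delta R ^+ (#|B| - 1) * \prod_(j in B) V (nth [::] ks j).
      move=> BP; have [c _ cB] := partition_block_color pP BP.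
      rewrite csub_split_coloring // plainw_split_coloring.
      have -> : [seq j <- enum 'I_(size ks) | mem B j] = enum B by rewrite enumT.
      rewrite (jones_flatten hV) ?size_map -?cardE; last first.
      - by rewrite all_map; apply/allP => j _; apply: split_component_diagram.
      - by apply/card_gt0P; exists c.
      by rewrite big_map big_enum.
    rewrite (eq_bigr _ VB) big_split /= prodrXr sum_card_pred // card_ord.
    congr (_ * _); rewrite PiE; have /and3P[/eqP cP tP _] := pP.
    by rewrite -(big_trivIset _ tP) cP; apply: eq_bigl => j; rewrite inE.
  have T0 : [set: 'I_(size ks)] != set0 by rewrite -card_gt0 cardsT card_ord.
  have /andP[P0 PT] := card_partition_bounds T0 pP.
  rewrite cardsT card_ord ltnS in PT.
  rewrite mulrAC mulrA -exprD (_ : (_ + _)%N = (size ks - 1)%N); first by rewrite mulrAC.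
  by rewrite addnC addnBA // subnK.
rewrite (jones_flatten hV) // [RHS]mulrC -/Pi; congr (_ * _).
rewrite /Ek sum_partition_falling_pred ?card_ord //.
- case: (size ks) ks0 => // m _.
  by rewrite subn1 /= exprVn -addn1 PoszD opprD addrC addrK exprnN.
- by rewrite invr_eq0; apply: E_neq0.
- exact: ratfun_natr_eq0.
Qed.

Lemma corollary_rhs_theta_rules : theta_rules V (corollary_rhs V).
Proof.
split.
- exact: corollary_rhs_laurent.
- exact: corollary_rhs_isotopic.
- exact: corollary_rhs_skein.
- exact: corollary_rhs_split_union.
Qed.

End Theta.

Theorem corollary2 (R : realType) (V theta : word -> ratfun R)
    (hV : is_jones V) (htheta : is_theta V theta)
    (n : nat) (L : word) (hL : diagram L) (hn : #|components L| = n) :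
  theta L =
  \sum_(1 <= k < n.+1)
    (-1) ^+ (k - 1) * (q + q^-1) ^+ (k - 1) * Ek k *
    \sum_(P : {set {set {set 'I_(size L)}}} |
          partition P (components L) && (#|P| == k)%N)
      q ^ (4 * nu P) * V_partition V P.
Proof.
by rewrite -(htheta.2 _ (corollary_rhs_theta_rules hV) L hL) -hn.
Qed.
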